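(* Let $(X,\mathscr A,\mu)$ be a $\sigma$-finite measure space, let $\phi\colon X\to X$ and $w\colon X\to\mathbb C$ be $\mathscr A$-measurable, and assume that $C_{\phi,w}$ is densely defined in $L^2(\mu)$. Assume that $\alpha<|w|$ a.e. $[\mu]$ with some positive $\alpha\in\mathbb R$. Then $C_\phi$ is densely defined and $C_{\phi,w}=M_wC_\phi$. Moreover, $(M_wC_\phi)^\dag=C_\phi^\dag M_w^\dag$ if and only if the following two conditions hold: (i) $\mathsf h_{\phi,\hat w}\leq\beta\,\mathsf h_{\phi,\hat{\mathbf 1}}$ a.e. $[\mu]$ with a positive $\beta\in\mathbb R$, where $\hat w=\frac{w}{\mathsf h_{\phi,w}\circ\phi}$ and $\hat{\mathbf 1}=\frac{1}{\mathsf h_\phi\circ\phi}$, (ii) $|w|^2=\mathsf E_\phi(|w|^2)$ a.e. $[\mu]$.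
   Context: Notation: $\mathcal D(T)$, $\mathcal N(T)$, $\mathcal R(T)$ are the domain, kernel and range of an operator $T$; products of operators have their natural (maximal) domains and equality of operators includes equality of domains. $L^2(\mu)$ is the complex Hilbert space of square $\mu$-integrable $\mathscr A$-measurable complex functions on $X$. Conventions: $\frac10=\infty$, $0\cdot\infty=0$. Weighted composition operators. For an $\mathscr A$-measurable $v\colon X\to\mathbb C$ put $\mu_v(\sigma)=\int_\sigma|v|^2\,d\mu$ and $\mu_v\circ\phi^{-1}(\sigma)=\mu_v(\phi^{-1}(\sigma))$ for $\sigma\in\mathscr A$. If $\mu_v\circ\phi^{-1}$ is absolutely continuous with respect to $\mu$, then $C_{\phi,v}$ is said to be well-defined and is the operator in $L^2(\mu)$ with $\mathcal D(C_{\phi,v})=\{f\in L^2(\mu)\colon v\cdot(f\circ\phi)\in L^2(\mu)\}$, $C_{\phi,v}f=v\cdot(f\circ\phi)$ (it is closed); $\mathsf h_{\phi,v}\colon X\to[0,\infty]$ is the Radon–Nikodym derivative: $\mu_v\circ\phi^{-1}(\Delta)=\int_\Delta\mathsf h_{\phi,v}\,d\mu$ for $\Delta\in\mathscr A$. ''Densely defined'' includes being well-defined. For the constant weight $\mathbf 1$ write $C_\phi:=C_{\phi,\mathbf 1}$, $\mathsf h_\phi:=\mathsf h_{\phi,\mathbf 1}$. $M_w$ is the multiplication operator: $\mathcal D(M_w)=\{f\in L^2(\mu)\colon wf\in L^2(\mu)\}$, $M_wf=wf$. When $C_\phi$ is densely defined, $\mathsf E_\phi(f)$ is the conditional expectation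 of an $\mathscr A$-measurable $f\colon X\to[0,\infty]$ with respect to the $\sigma$-algebra $\phi^{-1}(\mathscr A)$ and the measure $\mu$. Reciprocal. Let $T$ be a linear operator in a Hilbert space $\mathcal H$ with $\mathcal D(T)=\mathcal N(T)\oplus(\mathcal D(T)\cap\mathcal N(T)^\perp)$ (this holds for closed $T$). The reciprocal $T^\dag$ is the unique densely defined operator with domain $\mathcal D(T^\dag)=\mathcal R(T)\oplus\mathcal R(T)^\perp$ such that $TT^\dag f=P_{\overline{\mathcal R(T)}}f$ for $f\in\mathcal D(T^\dag)$, $T^\dag Tg=P_{\mathcal N(T)^\perp}g$ for $g\in\mathcal D(T)$, and $\mathcal N(T^\dag)=\mathcal R(T)^\perp$, where $P_M$ is the orthogonal projection onto the closed subspace $M$. *)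

(* Defs.v *)
From HB Require Import structures.
From mathcomp Require Import all_boot all_order all_algebra ring lra.
From mathcomp Require Import sesquilinear complex.
From mathcomp Require Import all_classical all_reals all_analysis.
From mathcomp Require Import measurable_realfun.

Set Implicit Arguments.
Unset Strict Implicit.
Unset Printing Implicit Defensive.
Import Order.TTheory GRing.Theory Num.Theory.
Import numFieldNormedType.Exports.

Local Open Scope classical_set_scope.
Local Open Scope quotient_scope.
Local Open Scope complex_scope.
Local Open Scope ring_scope.

Section cplx.
Context {R : realType}.
Implicit Types z : R[i].

(* |z|^2 as an element of R; `|z| is an element of R[i]. *)
Definition normsq z : R := complex.Re z ^+ 2 + complex.Im z ^+ 2.

Lemma normsq_ge0 z : 0 <= normsq z.
Proof. by rewrite addr_ge0 ?sqr_ge0. Qed.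

Lemma normsqE z : (normsq z)%:C = `|z| ^+ 2.
Proof.
case: z => a b; rewrite normc_def/= -[in RHS]rmorphXn/= sqr_sqrtr//.
by rewrite addr_ge0 ?sqr_ge0.
Qed.

Lemma normsqM z1 z2 : normsq (z1 * z2) = normsq z1 * normsq z2.
Proof. by case: z1 => a b; case: z2 => c d; rewrite /normsq/=; ring. Qed.

Lemma normsqD_le z1 z2 : normsq (z1 + z2) <= 2 * normsq z1 + 2 * normsq z2.
Proof.
case: z1 => a b; case: z2 => c d; rewrite /normsq/=.
have := sqr_ge0 (a - c); have := sqr_ge0 (b - d); nra.
Qed.

Lemma normsq_conj z : z * z^* = (normsq z)%:C.
Proof.
case: z => a b; apply/eqP; rewrite eq_complex/= /normsq/=.
by apply/andP; split; apply/eqP; ring.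
Qed.

End cplx.

Section L2fun.
Context d (X : measurableType d) (R : realType) (mu : {measure set X -> \bar R}).

Definition cmeasurable (f : X -> R[i]) :=
  measurable_fun setT (@complex.Re R \o f) /\ measurable_fun setT (@complex.Im R \o f).

Lemma cmeasurable_comp (phi : X -> X) f :
  measurable_fun setT phi -> cmeasurable f -> cmeasurable (f \o phi).
Proof.
move=> mphi [mRe mIm]; split.
- exact: (measurableT_comp mRe mphi).
- exact: (measurableT_comp mIm mphi).
Qed.

Lemma cmeasurableD f g : cmeasurable f -> cmeasurable g ->
  cmeasurable (fun x => f x + g x).
Proof.
move=> [f1 f2] [g1 g2]; split.
- rewrite (_ : _ \o _ = (@complex.Re R \o f) \+ (@complex.Re R \o g)).
    exact: measurable_funD.
  by apply/funext => x /=; case: (f x); case: (g x).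
- rewrite (_ : _ \o _ = (@complex.Im R \o f) \+ (@complex.Im R \o g)).
    exact: measurable_funD.
  by apply/funext => x /=; case: (f x); case: (g x).
Qed.

Lemma cmeasurableM f g : cmeasurable f -> cmeasurable g ->
  cmeasurable (fun x => f x * g x).
Proof.
move=> [f1 f2] [g1 g2]; split.
- rewrite (_ : _ \o _ = ((@complex.Re R \o f) \* (@complex.Re R \o g)) \-
                        ((@complex.Im R \o f) \* (@complex.Im R \o g))).
    by apply: measurable_funB; exact: measurable_funM.
  by apply/funext => x /=; case: (f x); case: (g x).
- rewrite (_ : _ \o _ = ((@complex.Re R \o f) \* (@complex.Im R \o g)) \+
                        ((@complex.Im R \o f) \* (@complex.Re R \o g))).
    by apply: measurable_funD; exact: measurable_funM.
  by apply/funext => x /=; case: (f x); case: (g x).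
Qed.

Lemma cmeasurable_cst c : cmeasurable (cst c).
Proof. by split; exact: measurable_cst. Qed.

Lemma cmeasurable_conj f : cmeasurable f -> cmeasurable (fun x => (f x)^*).
Proof.
move=> [f1 f2]; split.
- by rewrite (_ : _ \o _ = @complex.Re R \o f)//; apply/funext => x /=; case: (f x).
- rewrite (_ : _ \o _ = \- (@complex.Im R \o f)); first exact: measurableT_comp.
  by apply/funext => x /=; case: (f x).
Qed.

Lemma measurable_normsq f : cmeasurable f ->
  measurable_fun setT (fun x => normsq (f x)).
Proof.
by move=> [f1 f2]; apply: measurable_funD; exact: measurable_funX.
Qed.

Definition square_integrable (f : X -> R[i]) :=
  cmeasurable f /\ (\int[mu]_x (normsq (f x))%:E < +oo)%E.

Definition L2pred : {pred X -> R[i]} := [pred f | `[< square_integrable f >]].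

Lemma L2predP f : reflect (square_integrable f) (f \in L2pred).
Proof. exact: asboolP. Qed.

Lemma square_integrable_integrable f : square_integrable f ->
  mu.-integrable setT (fun x => (normsq (f x))%:E).
Proof.
move=> [mf finf]; apply/integrableP; split.
  by apply/measurable_EFinP; exact: measurable_normsq.
rewrite (eq_integral (fun x => (normsq (f x))%:E))// => x _.
by rewrite gee0_abs// lee_fin normsq_ge0.
Qed.

Lemma L2pred_submod_closed : submod_closed L2pred.
Proof.
split=> [|a f g].
  apply/L2predP; split; first exact: cmeasurable_cst.
  rewrite (eq_integral (cst 0%E)) ?integral0// => x _.
  by rewrite /normsq/= expr0n/= addr0.
move=> /L2predP Lf /L2predP Lg; apply/L2predP; split.
  exact: (cmeasurableD (cmeasurableM (cmeasurable_cst a) Lf.1) Lg.1).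
have If := square_integrable_integrable Lf; have Ig := square_integrable_integrable Lg.
pose h x := ((2 * normsq a)%:E * (normsq (f x))%:E + 2%:E * (normsq (g x))%:E)%E.
have Ih : mu.-integrable setT h.
  by apply: integrableD => //; exact: integrableZl.
apply: (@le_lt_trans _ _ (\int[mu]_x h x)%E); last exact: integrable_lty.
apply: ge0_le_integral => //.
- by move=> x _; rewrite lee_fin normsq_ge0.
- apply/measurable_EFinP; apply: measurable_normsq.
  exact: (cmeasurableD (cmeasurableM (cmeasurable_cst a) Lf.1) Lg.1).
- exact: (measurable_int mu).
- move=> x _; rewrite /h -!EFinM -EFinD lee_fin -mulrA -normsqM.
  exact: normsqD_le.
Qed.

HB.instance Definition _ := GRing.isSubmodClosed.Build _ _ L2pred
  L2pred_submod_closed.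

Record L2fun := MkL2fun { L2val :> X -> R[i] ; _ : L2val \in L2pred }.

HB.instance Definition _ := [isSub for L2val].
HB.instance Definition _ := [Choice of L2fun by <:].
HB.instance Definition _ := [SubChoice_isSubLmodule of L2fun by <:].

Lemma L2funP (f : L2fun) : square_integrable f.
Proof. exact/L2predP/(valP f). Qed.

Definition L2_eq (f g : L2fun) := `[< \forall x \ae mu, f x = g x >].

Lemma L2_eq_refl : reflexive L2_eq.
Proof. by move=> f; apply/asboolP; near=> x.
Unshelve. all: by end_near. Qed.

Lemma L2_eq_sym : symmetric L2_eq.
Proof.
by move=> f g; apply/idP/idP => /asboolP fg; apply/asboolP;
  apply: filterS fg => x.
Qed.

Lemma L2_eq_trans : transitive L2_eq.
Proof.
move=> f g h /asboolP gf /asboolP fh; apply/asboolP.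
by apply: filterS2 gf fh => x -> ->.
Qed.

Canonical L2_eq_equiv := EquivRel L2_eq L2_eq_refl L2_eq_sym L2_eq_trans.

End L2fun.

Section L2.
Context d (X : measurableType d) (R : realType) (mu : {measure set X -> \bar R}).

Definition L2 : Type := {eq_quot (@L2_eq _ X R mu)}.
HB.instance Definition _ := Choice.on L2.
HB.instance Definition _ := EqQuotient.on L2.

Definition L2cls (f : L2fun mu) : L2 := \pi_L2 f.

Definition L2_to_fun (u : L2) : X -> R[i] := repr u.
Coercion L2_to_fun : L2 >-> Funclass.

Implicit Types (f g h : L2fun mu) (u v : L2) (a : R[i]).

Lemma L2cls_eq f g : L2cls f = L2cls g <-> \forall x \ae mu, f x = g x.
Proof.
split=> [/eqP|fg]; first by rewrite eqmodE => /asboolP.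
by apply/eqP; rewrite eqmodE; exact/asboolP.
Qed.

Lemma reprK_L2 u : L2cls (repr u) = u.
Proof. exact: reprK. Qed.

Lemma L2_reprP f : \forall x \ae mu, L2cls f x = f x.
Proof. by apply/L2cls_eq; rewrite reprK_L2. Qed.

Lemma L2W (P : L2 -> Prop) : (forall f, P (L2cls f)) -> forall u, P u.
Proof. by move=> Pf u; rewrite -[u]reprK_L2. Qed.

Let add u v : L2 := L2cls (repr u + repr v).
Let opp u : L2 := L2cls (- repr u).
Let scale a u : L2 := L2cls (a *: repr u).

Let pi_add f g : add (L2cls f) (L2cls g) = L2cls (f + g).
Proof.
apply/L2cls_eq; have := L2_reprP f; have := L2_reprP g.
by apply: filterS2 => x /= gx fx; congr (_ + _).
Qed.

Let pi_opp f : opp (L2cls f) = L2cls (- f).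
Proof.
by apply/L2cls_eq; have := L2_reprP f; apply: filterS => x /= fx; congr (- _).
Qed.

Let pi_scale a f : scale a (L2cls f) = L2cls (a *: f).
Proof.
by apply/L2cls_eq; have := L2_reprP f; apply: filterS => x /= fx; congr (_ * _).
Qed.

Let addA : associative add.
Proof. by elim/L2W=> f; elim/L2W=> g; elim/L2W=> h; rewrite !pi_add addrA. Qed.

Let addC : commutative add.
Proof. by elim/L2W=> f; elim/L2W=> g; rewrite !pi_add addrC. Qed.

Let add0 : left_id (L2cls 0) add.
Proof. by elim/L2W=> f; rewrite pi_add add0r. Qed.

Let addN : left_inverse (L2cls 0) opp add.
Proof. by elim/L2W=> f; rewrite pi_opp pi_add addNr. Qed.

HB.instance Definition _ := GRing.isZmodule.Build L2 addA addC add0 addN.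

Let scaleA a b u : scale a (scale b u) = scale (a * b) u.
Proof. by elim/L2W: u => f; rewrite !pi_scale scalerA. Qed.

Let scale1 : left_id 1 scale.
Proof. by elim/L2W=> f; rewrite pi_scale scale1r. Qed.

Let scaleDr : right_distributive scale +%R.
Proof.
move=> a; elim/L2W=> f; elim/L2W=> g.
by rewrite [_ + _]pi_add !pi_scale [RHS]pi_add scalerDr.
Qed.

Let scaleDl u : {morph scale^~ u : a b / a + b}.
Proof.
by move=> a b; elim/L2W: u => f; rewrite !pi_scale [RHS]pi_add scalerDl.
Qed.

HB.instance Definition _ := GRing.Zmodule_isLmodule.Build R[i] L2
  scaleA scale1 scaleDr scaleDl.

Lemma L2clsD f g : L2cls (f + g) = L2cls f + L2cls g.
Proof. by rewrite [RHS]pi_add. Qed.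

Lemma L2clsZ a f : L2cls (a *: f) = a *: L2cls f.
Proof. by rewrite [RHS]pi_scale. Qed.

Lemma L2cls0 : L2cls 0 = 0 :> L2.
Proof. by []. Qed.

End L2.

Section dot_norm.
Context {C : numClosedFieldType} {V : lmodType C}.
Variable form : {dot V for Num.conj}.

Lemma dot_cauchy_schwarz u v : `|form u v| ^+ 2 <= form u u * form v v.
Proof.
have [->|v0] := eqVneq v 0; first by rewrite !linear0r normr0 expr0n.
have vv : 0 < form v v by rewrite dnorm_gt0.
pose a := form u v / form v v.
have uv : form u v = a * form v v by rewrite divfK// gt_eqF.
have wv : form (u - a *: v) v = 0.
  by rewrite linearBl linearZl_LR/= -uv subrr.
have -> : form u u = form (u - a *: v) (u - a *: v) + `|a| ^+ 2 * form v v.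
  rewrite -dnormZ -hnormDd/= ?subrK// linearZr_LR/= wv.
  by rewrite mulr0.
rewrite uv normrM exprMn (ger0_norm (ltW vv)) mulrDl -[X in _ + X]mulrA -expr2.
by rewrite lerDr mulr_ge0// dnorm_ge0.
Qed.

Lemma dot_triangle u v :
  sqrtC (form (u + v) (u + v)) <= sqrtC (form u u) + sqrtC (form v v).
Proof.
rewrite -ler_sqr ?nnegrE ?addr_ge0 ?sqrtC_ge0 ?dnorm_ge0//.
rewrite sqrrD !sqrtCK dnormD -addrA [leRHS]addrAC -addrA [leRHS]addrA.
rewrite -[leRHS]addrA lerD2l lerD2l.
have -> : form u v + (form u v)^* = 'Re (form u v) *+ 2.
  by rewrite ReE -mulr_natr divfK// pnatr_eq0.
rewrite lerMn2r/= -sqrtCM ?nnegrE ?dnorm_ge0//.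
apply: (le_trans (leif_Re_Creal _)).
rewrite -[leLHS]sqrCK ?normr_ge0// ler_sqrtC ?qualifE/= ?exprn_ge0 ?mulr_ge0 ?dnorm_ge0//.
exact: dot_cauchy_schwarz.
Qed.

End dot_norm.

Section cintegral.
Context d (X : measurableType d) (R : realType) (mu : {measure set X -> \bar R}).
Implicit Types (F G : X -> R[i]) (f g h : L2fun mu).

Definition cintegrable F :=
  mu.-integrable setT (fun x => (complex.Re (F x))%:E) /\
  mu.-integrable setT (fun x => (complex.Im (F x))%:E).

Definition cintegral F : R[i] :=
  (\int[mu]_x complex.Re (F x)) +i* (\int[mu]_x complex.Im (F x)).

Lemma cintegralD F G : cintegrable F -> cintegrable G ->
  cintegral (fun x => F x + G x) = cintegral F + cintegral G.
Proof.
move=> [F1 F2] [G1 G2]; apply/eqP; rewrite /cintegral eq_complex/=.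
rewrite -(RintegralD measurableT F1 G1) -(RintegralD measurableT F2 G2).
by apply/andP; split; apply/eqP; apply: eq_Rintegral => x _; case: (F x); case: (G x).
Qed.

Lemma cintegralZ (a : R[i]) F : cintegrable F ->
  cintegral (fun x => a * F x) = a * cintegral F.
Proof.
move=> [F1 F2]; case: a => a b; apply/eqP; rewrite /cintegral eq_complex/=.
have I c : mu.-integrable setT (fun x => (c * complex.Re (F x))%:E).
  by under eq_fun do rewrite EFinM; exact: integrableZl.
have J c : mu.-integrable setT (fun x => (c * complex.Im (F x))%:E).
  by under eq_fun do rewrite EFinM; exact: integrableZl.
rewrite -!RintegralZl// -(RintegralB measurableT (I a) (J b)).
rewrite -(RintegralD measurableT (J a) (I b)).
by apply/andP; split; apply/eqP; apply: eq_Rintegral => x _; case: (F x).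
Qed.

Lemma cintegral_conj F : cintegrable F ->
  cintegral (fun x => (F x)^*) = (cintegral F)^*.
Proof.
move=> [F1 F2]; apply/eqP; rewrite /cintegral eq_complex/= -mulN1r -RintegralZl//.
apply/andP; split; apply/eqP; apply: eq_Rintegral => x _; case: (F x) => //= a b.
by rewrite mulN1r.
Qed.

Lemma ae_eq_cintegral F G : cmeasurable F -> cmeasurable G ->
  (\forall x \ae mu, F x = G x) -> cintegral F = cintegral G.
Proof.
move=> [F1 F2] [G1 G2] FG; apply/eqP; rewrite /cintegral eq_complex/=.
apply/andP; split; apply/eqP; congr fine; apply: ae_eq_integral => //.
- exact/measurable_EFinP.
- exact/measurable_EFinP.
- by apply: filterS FG => x -> _.
- exact/measurable_EFinP.
- exact/measurable_EFinP.
- by apply: filterS FG => x -> _.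
Qed.

Lemma L2fun_cintegrable f g : cintegrable (fun x => f x * (g x)^*).
Proof.
have [mf _] := L2funP f; have [mg _] := L2funP g.
have [m1 m2] := cmeasurableM mf (cmeasurable_conj mg).
have If := square_integrable_integrable (L2funP f).
have Ig := square_integrable_integrable (L2funP g).
have Ih := integrableD measurableT If Ig.
have n0 x : 0 <= normsq (f x) + normsq (g x).
  by apply: addr_ge0; exact: normsq_ge0.
split; apply: (le_integrable _ _ _ Ih) => //; try exact/measurable_EFinP.
- move=> x _ /=; rewrite lee_fin (ger0_norm (n0 x)).
  case: (f x) => a b; case: (g x) => a' b'; rewrite /normsq/= ler_norml.
  have := sqr_ge0 (a - a'); have := sqr_ge0 (b - b').
  have := sqr_ge0 (a + a'); have := sqr_ge0 (b + b').
  by move=> *; apply/andP; split; nra.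
- move=> x _ /=; rewrite lee_fin (ger0_norm (n0 x)).
  case: (f x) => a b; case: (g x) => a' b'; rewrite /normsq/= ler_norml.
  have := sqr_ge0 (a - b'); have := sqr_ge0 (b - a').
  have := sqr_ge0 (a + b'); have := sqr_ge0 (b + a').
  by move=> *; apply/andP; split; nra.
Qed.

End cintegral.

Section L2_normed.
Context d (X : measurableType d) (R : realType) (mu : {measure set X -> \bar R}).
Implicit Types (f g h : L2fun mu) (u v : L2 mu) (a : R[i]).

Definition L2dot u v : R[i] := cintegral mu (fun x => u x * (v x)^*).

Lemma L2dotE f g :
  L2dot (L2cls f) (L2cls g) = cintegral mu (fun x => f x * (g x)^*).
Proof.
have m h : cmeasurable h by case: (L2funP h).
apply: ae_eq_cintegral.
- exact: (cmeasurableM (m (repr _)) (cmeasurable_conj (m (repr _)))).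
- exact: (cmeasurableM (m f) (cmeasurable_conj (m g))).
- by have := L2_reprP f; have := L2_reprP g; apply: filterS2 => x -> ->.
Qed.

Let dotDl v : {morph L2dot^~ v : u u' / u + u'}.
Proof.
elim/L2W: v => g; elim/L2W => f; elim/L2W => f'.
rewrite -L2clsD !L2dotE -cintegralD//; try exact: L2fun_cintegrable.
by congr cintegral; apply/funext => x; rewrite -mulrDl.
Qed.

Let dotZl v : scalable_for *%R (L2dot^~ v).
Proof.
move=> a; elim/L2W: v => g; elim/L2W => f.
rewrite -L2clsZ !L2dotE -cintegralZ//; last exact: L2fun_cintegrable.
by congr cintegral; apply/funext => x; rewrite mulrA.
Qed.

Let dot_herm u v : L2dot u v = (-1) ^+ false * Num.conj (L2dot v u).
Proof.
elim/L2W: u => f; elim/L2W: v => g.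
rewrite expr0 mul1r !L2dotE.
transitivity ((cintegral mu (fun x => g x * (f x)^*))^*) => //.
rewrite -cintegral_conj; last exact: L2fun_cintegrable.
congr cintegral; apply/funext => x.
case: (f x) => a b; case: (g x) => a' b'; apply/eqP; rewrite eq_complex/=.
by apply/andP; split; apply/eqP; ring.
Qed.

Let dotBl v : zmod_morphism (L2dot^~ v).
Proof. by move=> u u'; rewrite dotDl -scaleN1r dotZl mulN1r. Qed.

Let dotBr u : zmod_morphism (L2dot u).
Proof.
move=> v v'; rewrite ![L2dot u _]dot_herm !expr0 !mul1r.
by rewrite [L2dot _ u]dotBl rmorphB.
Qed.

Let dotZr u : scalable_for (Num.conj \; *%R) (L2dot u).
Proof.
move=> a v; rewrite ![L2dot u _]dot_herm !expr0 !mul1r.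
by rewrite [L2dot _ u]dotZl rmorphM.
Qed.

HB.instance Definition _ := isBilinear.Build R[i] (L2 mu) (L2 mu) R[i]
  *%R (Num.conj \; *%R) L2dot dotBl dotBr dotZl dotZr.

HB.instance Definition _ := isHermitianSesquilinear.Build R[i] (L2 mu)
  false Num.conj L2dot dot_herm.

Lemma L2dot_normsq f :
  L2dot (L2cls f) (L2cls f) = (fine (\int[mu]_x (normsq (f x))%:E))%:C.
Proof.
rewrite L2dotE; apply/eqP; rewrite /cintegral eq_complex/=; apply/andP; split; apply/eqP.
  by apply: eq_Rintegral => x _; rewrite normsq_conj.
rewrite (eq_Rintegral mu (g:=cst 0)); last by move=> x _; rewrite normsq_conj.
by rewrite Rintegral_cst// mul0r.
Qed.

Let dot_gt0 u : u != 0 -> 0 < L2dot u u.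
Proof.
elim/L2W: u => f f0; rewrite L2dot_normsq ltcR.
have If := square_integrable_integrable (L2funP f).
rewrite lt_neqAle fine_ge0 ?andbT; last first.
  by apply: integral_ge0 => x _; rewrite lee_fin normsq_ge0.
apply: contra f0 => /eqP/esym I0; apply/eqP/L2cls_eq.
have : (\int[mu]_x `|(normsq (f x))%:E| = 0)%E.
  under eq_integral do rewrite gee0_abs ?lee_fin ?normsq_ge0//.
  by rewrite -[LHS]fineK ?I0//; exact: integrable_fin_num.
move/ae_eq_integral_abs => /(_ measurableT (measurable_int mu If)).
apply: filterS => x /(_ I) [].
case: (f x) => a b; rewrite /normsq/= => /eqP.
rewrite paddr_eq0 ?sqr_ge0// !sqrf_eq0 => /andP[/eqP-> /eqP->] //.
Qed.

HB.instance Definition _ := isDotProduct.Build R[i] (L2 mu) L2dot dot_gt0.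

Let dot : {dot L2 mu for Num.conj} := L2dot.

Let norm u : R[i] := sqrtC (L2dot u u).

Let normD u v : norm (u + v) <= norm u + norm v.
Proof. exact: (dot_triangle dot). Qed.

Let normZ a u : norm (a *: u) = `|a| * norm u.
Proof.
rewrite /norm (dnormZ dot) sqrtCM ?qualifE/= ?exprn_ge0 ?(dnorm_ge0 dot)//.
by rewrite sqrCK.
Qed.

Let norm_eq0 u : norm u = 0 -> u = 0.
Proof. by move=> /eqP; rewrite (sqrt_dnorm_eq0 dot) => /eqP. Qed.

HB.instance Definition _ :=
  Lmodule_isNormed.Build R[i] (L2 mu) normD normZ norm_eq0.

Lemma L2_normE u : `|u| = sqrtC (L2dot u u).
Proof. by []. Qed.

End L2_normed.

(* A partial operator [T] in [V]: [T f = None] means that [f] is outside the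
   domain, so Leibniz equality of operators includes equality of domains. *)
Definition poperator (V : Type) := V -> option V.

(* In this section the norm of [V] is meant to be the one induced by [ip], as it
   is for [L2dot], see [L2_normE]. *)
Section operators.
Context {C : numClosedFieldType} {V : normedModType C}.
Variable ip : {dot V for Num.conj}.
Implicit Types (T S : poperator V) (M : set V).

Definition dom T : set V := [set f | T f != None].
Definition ran T : set V := [set g | exists f, T f = Some g].
Definition ker T : set V := [set f | T f = Some 0].

Definition linear_op T :=
  T 0 = Some 0 /\
  forall a f g u v, T f = Some u -> T g = Some v ->
    T (a *: f + g) = Some (a *: u + v).

Definition op_comp T S : poperator V := fun f => obind T (S f).

Definition orthc M : set V := [set f | forall g, M g -> ip f g = 0].

(* The projection is kept relational, so that it makes sense without assuming
   completeness. *)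
Definition is_orth_proj M f g := M g /\ orthc M (f - g).

(* The orthogonality of the two summands in [reciprocal_dom] is automatic. *)
Record is_reciprocal T S : Prop := IsReciprocal {
  reciprocal_linear : linear_op S ;
  reciprocal_dense : dense (dom S) ;
  reciprocal_dom :
    dom S = [set f + g | f in ran T & g in orthc (ran T)] ;
  reciprocal_rinv : forall f, dom S f ->
    exists2 g, op_comp T S f = Some g & is_orth_proj (closure (ran T)) f g ;
  reciprocal_linv : forall g, dom T g ->
    exists2 f, op_comp S T g = Some f & is_orth_proj (orthc (ker T)) g f ;
  reciprocal_ker : ker S = orthc (ran T) }.

Lemma orthcB M f g : orthc M f -> orthc M g -> orthc M (f - g).
Proof.
move=> Mf Mg h Mh; have := Mf h Mh; have := Mg h Mh => Mgh Mfh.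
have -> : ip (f - g) h = ip f h - ip g h by exact: linearBl.
by rewrite Mfh Mgh subrr.
Qed.

Lemma is_orth_proj_unique M f g g' :
  is_orth_proj (orthc M) f g -> is_orth_proj (orthc M) f g' -> g = g'.
Proof.
move=> [Mg fg] [Mg' fg']; apply/eqP; rewrite -subr_eq0 -(dnorm_eq0 ip).
rewrite [X in ip X _](_ : _ = (f - g') - (f - g)).
  by rewrite (orthcB fg' fg) ?eqxx//; exact: orthcB.
by rewrite opprB [RHS]addrC addrA subrK.
Qed.

Lemma is_reciprocal_unique T S S' :
  is_reciprocal T S -> is_reciprocal T S' -> S = S'.
Proof.
move=> [[_ lS] _ dS _ linvS kS] [[_ lS'] _ dS' _ linvS' kS'].
apply/funext => f; have [|nSf] := pselect (dom S f); last first.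
  have : ~ dom S' f by rewrite dS' -dS.
  by move: nSf; rewrite /dom/=; case: (S f) => [?|_]; case: (S' f) => // ? [].
rewrite dS => -[t [g Tg] [h hT <-]].
have Sh : S h = Some 0 by have : orthc (ran T) h by []; rewrite -kS.
have S'h : S' h = Some 0 by have : orthc (ran T) h by []; rewrite -kS'.
have gT : dom T g by rewrite /dom/= Tg.
have [p] := linvS _ gT; have [p'] := linvS' _ gT.
rewrite /op_comp Tg/= => S't pr' St pr.
rewrite -[t]scale1r (lS 1 _ _ _ _ St Sh) (lS' 1 _ _ _ _ S't S'h).
by rewrite (is_orth_proj_unique pr pr').
Qed.

(* By [is_reciprocal_unique] the choice is immaterial; an operator without a
   reciprocal gets the operator with empty domain as a dummy. *)
Definition reciprocal T : poperator V :=
  xget (fun=> None) [set S | is_reciprocal T S].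

End operators.

Section weighted_composition.
Context d (X : measurableType d) (R : realType) (mu : {measure set X -> \bar R}).
Implicit Types (phi : X -> X) (v w : X -> R[i]) (u : L2 mu).

(* The class of [f] in L^2(mu), if [f] is square integrable. *)
Definition L2class (f : X -> R[i]) : option (L2 mu) :=
  omap (@L2cls _ X R mu) (insub f).

Lemma ae_eq_L2class f g : cmeasurable f -> cmeasurable g ->
  (\forall x \ae mu, f x = g x) -> L2class f = L2class g.
Proof.
move=> mf mg fg; rewrite /L2class.
have I : (\int[mu]_x (normsq (f x))%:E = \int[mu]_x (normsq (g x))%:E)%E.
  apply: ae_eq_integral => //; last by apply: filterS fg => x -> _.
  - exact/measurable_EFinP/measurable_normsq.
  - exact/measurable_EFinP/measurable_normsq.
case: insubP => [f' /L2predP[_ If] ff'|]; case: insubP => [g' /L2predP[_ Ig] gg'|] //=.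
- by congr Some; apply/L2cls_eq; rewrite ff' gg'.
- by move=> /negP[]; apply/L2predP; split => //; rewrite -I.
- by move=> /negP[]; apply/L2predP; split => //; rewrite I.
Qed.

(* The set function D |-> mu_v (phi^-1 D), where mu_v has density |v|^2. *)
Definition wpushforward phi v (D : set X) : \bar R :=
  (\int[mu]_(x in phi @^-1` D) (normsq (v x))%:E)%E.

Definition well_defined phi v := wpushforward phi v `<< mu.

(* [u] is applied through a representative; [wcomp_cls] shows that the choice of
   representative is immaterial when the operator is well-defined. *)
Definition wcomp phi v : poperator (L2 mu) :=
  fun u => L2class (fun x => v x * u (phi x)).

Lemma wcomp_cls phi v (f : L2fun mu) : measurable_fun setT phi ->
  cmeasurable v -> well_defined phi v ->
  wcomp phi v (L2cls f) = L2class (fun x => v x * f (phi x)).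
Proof.
move=> mphi mv /null_content_dominatesP wd.
have m (h : L2fun mu) : cmeasurable h by case: (L2funP h).
apply: ae_eq_L2class.
- exact: (cmeasurableM mv (cmeasurable_comp mphi (m (repr (L2cls f))))).
- exact: (cmeasurableM mv (cmeasurable_comp mphi (m f))).
have [N [mN N0 subN]] := L2_reprP f.
have mpN : measurable (phi @^-1` N) by rewrite -[X in measurable X]setTI; exact: mphi.
have : (\int[mu]_(x in phi @^-1` N) `|(normsq (v x))%:E| = 0)%E.
  rewrite -[RHS](wd _ mN N0); apply: eq_integral => x _.
  by rewrite gee0_abs// lee_fin normsq_ge0.
move/ae_eq_integral_abs => /(_ mpN).
have mnv : measurable_fun (phi @^-1` N) (fun x => (normsq (v x))%:E).
  by apply: measurable_funTS; exact/measurable_EFinP/measurable_normsq.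
move=> /(_ mnv); apply: filterS => x vx.
have [Nx|Nx] := pselect (N (phi x)); last first.
  by congr (_ * _); apply: contrapT => /subN.
case: (v x) (vx Nx) => a b [] /eqP.
rewrite paddr_eq0 ?sqr_ge0// !sqrf_eq0/= => /andP[/eqP-> /eqP->].
by rewrite !mul0r.
Qed.

Definition comp_op phi := wcomp phi (cst 1).

Definition mul_op w : poperator (L2 mu) := fun u => L2class (fun x => w x * u x).

Definition densely_defined phi v :=
  well_defined phi v /\ dense (dom (wcomp phi v)).

(* h takes values in [0, +oo] and mu_v \o phi^-1 need not be sigma-finite, so the
   library's Radon-Nikodym derivative of a finite charge does not apply. As mu is
   meant to be sigma-finite, h is unique up to a mu-null set. *)
Definition is_RN_deriv phi v (h : X -> \bar R) :=
  [/\ measurable_fun setT h, forall x, (0 <= h x)%E &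
      forall D, measurable D -> wpushforward phi v D = (\int[mu]_(x in D) h x)%E].

Definition RN_deriv phi v : X -> \bar R :=
  xget (cst 0%E) [set h | is_RN_deriv phi v h].

(* v / (h_{phi,v} \o phi). The dummy values [fine +oo = 0] and [0^-1 = 0] are
   used at points x where h_{phi,v} (phi x) is 0 or +oo. When C_{phi,v} is densely
   defined these points form a set on which v = 0 mu-a.e., and there the value 0
   agrees with the conventions 0 * oo = 0 and 1 / 0 = oo. *)
Definition hat phi v : X -> R[i] :=
  fun x => v x / (fine (RN_deriv phi v (phi x)))%:C.

(* E_phi f, the conditional expectation of f : X -> [0, +oo] with respect to mu and
   the sigma-algebra of all phi^-1 D, D measurable. *)
Definition is_cond_exp phi (f g : X -> \bar R) :=
  [/\ measurable_fun (setT : set (g_sigma_algebra_preimageType phi)) g,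
      forall x, (0 <= g x)%E &
      forall D, measurable D ->
        (\int[mu]_(x in phi @^-1` D) g x = \int[mu]_(x in phi @^-1` D) f x)%E].

Definition cond_exp phi f : X -> \bar R :=
  xget (cst 0%E) [set g | is_cond_exp phi f g].

End weighted_composition.

Arguments L2dot {d X R} mu u v.
Arguments L2class {d X R} mu f.
Arguments wcomp {d X R} mu phi v _.
Arguments comp_op {d X R} mu phi _.
Arguments mul_op {d X R} mu w _.

(* Main.v *)
Require Import Defs.
From HB Require Import structures.
From mathcomp Require Import all_boot all_order all_algebra ring lra.
From mathcomp Require Import sesquilinear complex.
From mathcomp Require Import all_classical all_reals all_analysis.
From mathcomp Require Import measurable_realfun.

Set Implicit Arguments.
Unset Strict Implicit.
Unset Printing Implicit Defensive.

Import Order.TTheory GRing.Theory Num.Theory.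
Import numFieldNormedType.Exports.

Local Open Scope classical_set_scope.
Local Open Scope complex_scope.
Local Open Scope ring_scope.

(** Write C = C_phi, M = M_w, T = M C, and let ' denote reciprocals.

    The bound alpha < |w| makes M a bijection of its domain onto L^2 with a
    bounded inverse.  Hence T = C_{phi,w} (wcomp_mul_comp), the operators T and
    C have the same kernel, and M' is the inverse of M.  A linear operator S
    with closed kernel has a reciprocal whose graph is explicit
    (reciprocalP): S' f = k means f = S k + h with k orthogonal to ker S and h
    orthogonal to ran S.  The density of the domain of S' rests on the
    orthogonal projection onto the closure of ran S, hence on the completeness
    of L^2 (L2_complete, L2_projection).

    Comparing the graphs of T' and C' M' shows that they agree if and only if

      (P)  h _|_ ran T  implies  h / w _|_ ran C

    (reciprocal_mul_comp_iff).  If they agree, evaluate both sides at h.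
    Conversely, under (P), let f = p + q be the decomposition of f along the
    closure of ran T and its orthogonal complement; then f / w = p / w + q / w
    is the decomposition of f / w along the closure of ran C and its
    complement, because division by w is bounded, so f and f / w are in the
    respective domains together.

    Condition (P) says that |w|^2 is almost everywhere a function of phi, which
    is the conditional expectation identity.  Indeed (P) dualizes to: for g in
    the domain of C, the function (g o phi) / conj w belongs to the closure of
    ran T, and every element of that closure has the form w (k o phi)
    (closure_ran_quotient).  For the indicator g of a set F this reads
    |w|^(-2) = k o phi on phi^-1 F, and countably many such F cover X since
    C_{phi,w} is densely defined (factor_of_orthc_quotient,
    densely_defined_cover).  If conversely |w|^2 = a o phi, then
    (g o phi) / conj w = w ((g / a) o phi) is in ran T, which gives (P)
    (orthc_quotient_of_factor).

    The bound between Radon-Nikodym derivatives is a consequence of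
    alpha < |w|.  The derivative attached to the weight v / (h_v o phi) is
    1 / h_v where h_v > 0, and 0 elsewhere (is_RN_deriv_hat); moreover
    h_w >= alpha^2 h_1, and h_w and h_1 have the same zeros, so that
    beta = alpha^-2 works (RN_deriv_hat_le). *)

(** * Integrals that determine functions, and densities *)
Section measure.
Context d (X : measurableType d) (R : realType).
Implicit Types (mu nu : {measure set X -> \bar R}) (f g : X -> \bar R).
Local Open Scope ereal_scope.

(** Integrating over the part of {g < f} where g <= m inside a set of finite
    measure forces that part to be null; these parts exhaust {g < f} because g
    is finite there.  The integrals over X may be infinite, as for densities of
    sigma-finite measures. *)
Lemma ae_le_of_integral mu f g : sigma_finite setT mu ->
  measurable_fun setT f -> measurable_fun setT g ->
  (forall x, 0 <= f x) -> (forall x, 0 <= g x) ->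
  (forall D, measurable D -> \int[mu]_(x in D) f x <= \int[mu]_(x in D) g x) ->
  \forall x \ae mu, f x <= g x.
Proof.
move=> [F TF mF] mf mg f0 g0 fg.
pose E (n m : nat) := F n `&` [set x | g x <= m%:R%:E] `&` [set x | g x < f x].
have mE n m : measurable (E n m).
  apply: measurableI; last first.
    by rewrite -[X in measurable X]setTI; exact: measurable_lte.
  apply: measurableI; first exact: (mF n).1.
  by rewrite -[X in measurable X]setTI; exact: emeasurable_fun_infty_c.
have negE n m : mu.-negligible (E n m).
  have Ig : mu.-integrable (E n m) g.
    apply/integrableP; split; first exact: measurable_funTS.
    under eq_integral do rewrite gee0_abs//.
    apply: (@le_lt_trans _ _ (\int[mu]_(x in E n m) cst m%:R%:E x)).
      apply: ge0_le_integral => //; first exact: measurable_funTS.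
      by move=> x [[_ +] _].
    rewrite integral_cst// lte_mul_pinfty// ?lee_fin//.
    by apply: le_lt_trans (mF n).2; apply: le_measure;
      rewrite ?inE//; [exact: (mF n).1|move=> x [[]]].
  have gf : ae_eq mu (E n m) g f.
    apply: integral_ae_eq => //; first exact: measurable_funTS.
    move=> D DE mD; apply/eqP; rewrite eq_le fg// andbT.
    apply: ge0_le_integral => //; try exact: measurable_funTS.
    by move=> x Dx; have [_ /ltW] := DE _ Dx.
  apply: negligibleS gf => x Ex /= /(_ Ex) gfx.
  by case: Ex => _ /=; rewrite gfx ltxx.
have := negligible_bigcup (fun n => negligible_bigcup (negE n)).
apply: negligibleS => x /= /negP; rewrite -ltNge => gfx.
have [n _ Fnx] : (\bigcup_i F i) x by rewrite -TF.
have gfin : g x \is a fin_num.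
  by rewrite ge0_fin_numE//; apply: lt_le_trans gfx _; rewrite leey.
exists n => //; exists (Num.trunc (fine (g x))).+1 => //; split => //; split => //=.
by rewrite -[g x]fineK// lee_fin ltW// truncnS_gt.
Qed.

Lemma ae_eq_of_integral mu f g : sigma_finite setT mu ->
  measurable_fun setT f -> measurable_fun setT g ->
  (forall x, 0 <= f x) -> (forall x, 0 <= g x) ->
  (forall D, measurable D -> \int[mu]_(x in D) f x = \int[mu]_(x in D) g x) ->
  \forall x \ae mu, f x = g x.
Proof.
move=> sf mf mg f0 g0 fg.
have fLg : \forall x \ae mu, f x <= g x.
  by apply: ae_le_of_integral => // D mD; rewrite fg.
have gLf : \forall x \ae mu, g x <= f x.
  by apply: ae_le_of_integral => // D mD; rewrite fg.
by apply: filterS2 fLg gLf => x xy yx; apply/eqP; rewrite eq_le xy yx.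
Qed.

Import HBNNSimple.

(** By approximation of g with simple functions, for which this is the
    hypothesis on nu. *)
Lemma integral_density mu nu (r : X -> R) g E :
  measurable_fun setT r -> (forall x, (0 <= r x)%R) ->
  (forall D, measurable D -> nu D = \int[mu]_(x in D) (r x)%:E) ->
  (forall x, 0 <= g x) -> measurable E -> measurable_fun E g ->
  \int[nu]_(x in E) g x = \int[mu]_(x in E) (g x * (r x)%:E).
Proof.
move=> mr r0 nuE g0 mE mg; pose h := nnsfun_approx mE mg.
have mr' : measurable_fun E (fun x => (r x)%:E).
  by apply/measurable_EFinP; exact: measurable_funTS.
have -> : \int[nu]_(x in E) g x =
    lim (\int[nu]_(x in E) (EFin \o h n) x @[n --> \oo]).
  have gE x : E x -> g x = lim ((EFin \o h n) x @[n --> \oo]).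
    by move=> Ex; apply/esym/cvg_lim => //; exact: cvg_nnsfun_approx.
  under eq_integral => x /[!inE] /gE -> //.
  apply: monotone_convergence => //.
  - by move=> n; apply/measurable_EFinP; apply: measurable_funTS.
  - by move=> n x Ex //=; rewrite lee_fin.
  - by move=> x Ex a b ab; rewrite lee_fin; exact/lefP/nd_nnsfun_approx.
have -> : \int[mu]_(x in E) (g x * (r x)%:E) =
    lim (\int[mu]_(x in E) ((EFin \o h n) x * (r x)%:E) @[n --> \oo]).
  have gr x : E x ->
      g x * (r x)%:E = lim (((EFin \o h n) x * (r x)%:E) @[n --> \oo]).
    by move=> Ex; apply/esym/cvg_lim => //; apply: cvgeZr => //;
      exact: cvg_nnsfun_approx.
  under eq_integral => x /[!inE] /gr -> //.
  apply: monotone_convergence => [//| | |].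
  - by move=> n; apply: emeasurable_funM => //; apply/measurable_funTS/measurable_EFinP.
  - by move=> n x Ex /=; rewrite mule_ge0 ?lee_fin.
  - by move=> x Ex a b ab/=; rewrite lee_wpmul2r ?lee_fin//; exact/lefP/nd_nnsfun_approx.
suff suf n : \int[mu]_(x in E) ((EFin \o h n) x * (r x)%:E) =
    \int[nu]_(x in E) (EFin \o h n) x.
  by under [in RHS]eq_fun do rewrite suf.
transitivity (\int[nu]_(x in E)
   (\sum_(y \in range (h n)) (y * \1_(h n @^-1` [set y]) x)%:E)); last first.
  by apply: eq_integral => t tE; rewrite /= fimfunE -fsumEFin.
have indich m y : measurable_fun E (fun x => (y * \1_(h m @^-1` [set y]) x)%:E).
  by apply: (measurable_comp measurableT) => //; exact: measurable_funM.
rewrite ge0_integral_fsum//; last by move=> m y Ey; exact: nnfun_muleindic_ge0.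
transitivity (\int[mu]_(x in E) (\sum_(y \in range (h n))
    (y * \1_(h n @^-1` [set y]) x)%:E * (r x)%:E)).
  under [RHS]eq_integral => x xE.
    rewrite -ge0_mule_fsuml => [|y]; last exact: nnfun_muleindic_ge0.
    rewrite fsumEFin // -(fimfunE _ x); over.
  by [].
rewrite ge0_integral_fsum//; last 2 first.
  - by move=> y; exact: emeasurable_funM.
  - move=> m y Ey; apply: mule_ge0; last by rewrite lee_fin.
    exact: nnfun_muleindic_ge0.
apply: eq_fsbigr => y yhn.
under [RHS]eq_integral do rewrite EFinM.
rewrite integralZl_indic_nnsfun => //.
under eq_integral do rewrite EFinM -muleA.
rewrite ge0_integralZl//.
- under eq_integral do rewrite muleC.
  rewrite (eq_integral ((EFin \o r) \_ (h n @^-1` [set y]))); last first.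
    by move=> x xE; rewrite epatch_indic.
  by rewrite -integral_mkcondr -nuE// ?integral_indic// setIC//; exact: measurableI.
- by apply: emeasurable_funM => //; exact/measurable_EFinP.
- by move=> t Et; rewrite mule_ge0 ?lee_fin.
- by move: yhn; rewrite inE => -[t _ <-]; rewrite lee_fin.
Qed.


(** A version for two sigma-finite measures: the densities of the restrictions
    of nu to the pieces of a disjoint cover are glued together.  The density
    is real-valued, so it can be inverted pointwise. *)
Lemma sigma_finite_radon_nikodym
    (mu : {sigma_finite_measure set X -> \bar R}) nu :
  sigma_finite setT nu -> nu `<< mu ->
  exists h : X -> R, [/\ measurable_fun setT h, forall x, (0 <= h x)%R &
    forall D, measurable D -> nu D = \int[mu]_(x in D) (h x)%:E].
Proof.
move=> [F TF mF] /null_content_dominatesP numu.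
pose G := seqDU F.
have mG n : measurable (G n) by apply: seqDU_measurable => k; exact: (mF k).1.
have TG : \bigcup_n G n = setT by rewrite -seqDU_bigcup_eq.
have Gfin n : nu (G n) < +oo.
  apply: le_lt_trans (mF n).2; apply: le_measure; rewrite ?inE//.
    exact: (mF n).1.
  exact: subset_seqDU.
have dom n : mfrestr (mG n) (Gfin n) `<< mu.
  apply/null_content_dominatesP => A mA A0; apply/eqP.
  rewrite /mfrestr /mrestr -measure_le0 -(numu A mA A0).
  by apply: le_measure; rewrite ?inE//; exact: measurableI.
have [h_ hP] := choice (fun n => radon_nikodym_sigma_finite (dom n)).
pose idx x := xget 0%N [set n | G n x].
have idxE n x : G n x -> idx x = n.
  move=> Gnx; apply: xget_unique => // m Gmx.
  by apply: (@trivIset_seqDU _ F) => //; exists x.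
pose h x := fine (h_ (idx x) x).
have hE n x : G n x -> (h x)%:E = h_ n x.
  by move=> /idxE nx; rewrite /h nx fineK//; have [_ ->] := hP n.
have mh_ n : measurable_fun setT (h_ n).
  by have [_ _ /(measurable_int mu)] := hP n.
have mh : measurable_fun setT h.
  apply/measurable_EFinP; rewrite -TG.
  apply/(measurable_fun_bigcup _ mG) => n.
  apply: (@eq_measurable_fun _ _ _ _ _ (h_ n)).
    by move=> x; rewrite inE => /hE.
  exact: measurable_funTS.
exists h; split => [//|x|D mD]; first by rewrite fine_ge0//; have [->] := hP (idx x).
have mDG n : measurable (D `&` G n) by exact: measurableI.
have tDG : trivIset setT (fun n => D `&` G n).
  by apply: trivIset_setIl; exact: trivIset_seqDU.
have DE : D = \bigcup_n (D `&` G n) by rewrite -setI_bigcupr TG setIT.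
rewrite [in RHS]DE ge0_integral_bigcup//; last 2 first.
- by rewrite -DE; apply/measurable_funTS/measurable_EFinP.
- by move=> x _; rewrite lee_fin fine_ge0//; have [->] := hP (idx x).
rewrite [in LHS]DE measure_bigcup//.
rewrite eseries_mkcond; apply: eq_eseriesr => n _; rewrite in_setT.
transitivity (\int[mu]_(x in D `&` G n) h_ n x); last first.
  by apply: eq_integral => x; rewrite inE => -[_ /hE].
have [_ _ _ <-//] := hP n.
by rewrite /= /mfrestr /mrestr -setIA setIid.
Qed.

(** The Doob-Dynkin lemma.  Each set {q < g}, q rational, is the preimage of
    some A_q, and a y is the supremum of the q >= 0 such that y is in A_q. *)
Lemma preimage_measurable_factor (phi : X -> X) g :
  measurable_fun (setT : set (g_sigma_algebra_preimageType phi)) g ->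
  (forall x, 0 <= g x) ->
  exists a : X -> \bar R, [/\ measurable_fun setT a, forall y, 0 <= a y &
    forall x, g x = a (phi x)].
Proof.
move=> mg g0.
have pre (q : rat) : exists A, measurable A /\
    phi @^-1` A = [set x | (ratr q)%:E < g x].
  have [A mA AE] : measurable
      (setT `&` [set x : g_sigma_algebra_preimageType phi | (ratr q)%:E < g x]).
    exact: emeasurable_fun_o_infty.
  by exists A; split => //; move: AE; rewrite !setTI.
have [A /all_and2[mA AE]] := choice pre.
pose s n y : \bar R := if unpickle n is Some q
  then (Num.max 0%R (ratr q) * \1_(A q) y)%:E else 0.
have s0 n y : 0 <= s n y.
  rewrite /s; case: unpickle => // q; rewrite lee_fin mulr_ge0//.
  by rewrite le_max lexx.
have ms n : measurable_fun setT (s n).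
  rewrite /s; case: (unpickle n) => [q|]; last exact: measurable_cst.
  by apply/measurable_EFinP; apply: measurable_funM => //; exact: measurable_indic.
pose a y := esups (s^~ y) 0%N.
have a_ub n y : s n y <= a y by apply: ereal_sup_ubound; exists n.
exists a; split.
- exact: measurable_fun_esups.
- by move=> y; apply: le_trans (a_ub 0%N y).
move=> x; apply/eqP; rewrite eq_le; apply/andP; split; last first.
  apply: ge_ereal_sup => _ [n _ <-]; rewrite /s.
  case: unpickle => [q|//]; rewrite indicE.
  have [/set_mem Aq|_] := boolP (phi x \in A q); last by rewrite mulr0.
  rewrite mulr1 EFin_max ge_max g0/= ltW//.
  by have : (phi @^-1` A q) x by []; rewrite AE.
rewrite leNgt; apply/negP => ag.
have a0 : 0 <= a (phi x) by apply: le_trans (a_ub 0%N _).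
have afin : a (phi x) \is a fin_num.
  by rewrite ge0_fin_numE//; apply: lt_le_trans ag _; rewrite leey.
have [q aq qg] : exists2 q : rat, a (phi x) < (ratr q)%:E & (ratr q)%:E < g x.
  rewrite -(fineK afin) in ag *.
  case: (g x) (g0 x) ag => [r _|_ _|//].
    by rewrite lte_fin => /rat_in_itvoo[q /[!in_itv]/= /andP[? ?]]; exists q.
  have /rat_in_itvoo[q /[!in_itv]/= /andP[? ?]] :
    (fine (a (phi x)) < fine (a (phi x)) + 1)%R by rewrite ltrDl.
  by exists q; rewrite ?ltry.
have := a_ub (pickle q) (phi x).
rewrite /s pickleK indicE mem_set ?mulr1; last first.
  by rewrite -[A q _]/((phi @^-1` A q) x) AE.
by rewrite leNgt (lt_le_trans aq)// lee_fin le_max lexx orbT.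
Qed.

End measure.


(** * The squared norm and the inner product of L^2 *)
Section L2geometry.
Context d (X : measurableType d) (R : realType) (mu : {measure set X -> \bar R}).
Implicit Types (u v f : L2 mu) (a : R[i]) (M : set (L2 mu)).

Lemma L2dotDl u u' v : L2dot mu (u + u') v = L2dot mu u v + L2dot mu u' v.
Proof. exact: linearDl. Qed.

Lemma L2dotDr u v v' : L2dot mu u (v + v') = L2dot mu u v + L2dot mu u v'.
Proof. exact: linearDr. Qed.

Lemma L2dotBr u v v' : L2dot mu u (v - v') = L2dot mu u v - L2dot mu u v'.
Proof. exact: linearBr. Qed.

Lemma L2dotZr a u v : L2dot mu u (a *: v) = a^* * L2dot mu u v.
Proof. exact: (linearZr_LR (L2dot mu)). Qed.

Lemma L2dotZl a u v : L2dot mu (a *: u) v = a * L2dot mu u v.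
Proof. exact: (linearZl_LR (L2dot mu)). Qed.

Lemma L2dotC u v : L2dot mu u v = (L2dot mu v u)^*.
Proof. by rewrite [LHS](hermC (L2dot mu)) /= expr0 mul1r. Qed.

Lemma L2dot_eq0C u v : L2dot mu u v = 0 -> L2dot mu v u = 0.
Proof. by move=> uv; rewrite L2dotC uv rmorph0. Qed.

(** The norm of L^2 takes values in R[i]; its square as an element of R is what
    convexity and integration arguments need. *)
Definition nsq u : R := complex.Re (L2dot mu u u).

Lemma L2dotuu u : L2dot mu u u = (nsq u)%:C.
Proof. by rewrite /nsq -(reprK_L2 u) L2dot_normsq. Qed.

Lemma nsq_ge0 u : 0 <= nsq u.
Proof. by rewrite -lecR -L2dotuu (dnorm_ge0 (L2dot mu)). Qed.

Lemma nsq_integral u : (nsq u)%:E = (\int[mu]_x (normsq (u x))%:E)%E.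
Proof.
rewrite /nsq -{1 2}(reprK_L2 u) L2dot_normsq/= fineK//.
rewrite ge0_fin_numE; first by case: (L2funP (repr u)).
by apply: integral_ge0 => x _; rewrite lee_fin normsq_ge0.
Qed.

Lemma nsq_eq0 u : nsq u = 0 -> u = 0.
Proof.
by move=> u0; apply/eqP; rewrite -(dnorm_eq0 (L2dot mu)) [X in X == _]L2dotuu u0.
Qed.

Lemma nsqD u v :
  nsq (u + v) = nsq u + nsq v + 2 * complex.Re (L2dot mu u v).
Proof.
rewrite /nsq L2dotDl !L2dotDr (L2dotC v u).
case: (L2dot mu u u) => a b; case: (L2dot mu v v) => a' b'.
by case: (L2dot mu u v) => p q /=; ring.
Qed.

Lemma nsqZ a u : nsq (a *: u) = normsq a * nsq u.
Proof.
rewrite {1}/nsq L2dotZl L2dotZr L2dotuu.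
by case: a => p q; rewrite /normsq/=; ring.
Qed.

Lemma nsqN u : nsq (- u) = nsq u.
Proof. by rewrite -scaleN1r nsqZ /normsq/=; ring. Qed.

Lemma nsqBC u v : nsq (u - v) = nsq (v - u).
Proof. by rewrite -nsqN opprB. Qed.

Lemma L2_parallelogram u v : nsq (u + v) + nsq (u - v) = 2 * nsq u + 2 * nsq v.
Proof.
rewrite !nsqD nsqN -scaleN1r L2dotZr.
by case: (L2dot mu u v) => a b /=; ring.
Qed.

Lemma nsqD_le u v : nsq (u + v) <= 2 * nsq u + 2 * nsq v.
Proof. by rewrite -L2_parallelogram lerDl nsq_ge0. Qed.

Lemma L2_cauchy_schwarz u v : normsq (L2dot mu u v) <= nsq u * nsq v.
Proof.
by rewrite -lecR normsqE rmorphM/= -!L2dotuu (dot_cauchy_schwarz (L2dot mu)).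
Qed.

Lemma normsq_eq0 a : normsq a = 0 -> a = 0.
Proof.
case: a => p q; rewrite /normsq/= => /eqP.
by rewrite paddr_eq0 ?sqr_ge0// !sqrf_eq0 => /andP[/eqP-> /eqP->].
Qed.

Lemma normsq_gt0 a : (0 < normsq a) = (a != 0).
Proof.
rewrite lt_neqAle normsq_ge0 andbT eq_sym; congr negb; apply/eqP/eqP.
  exact: normsq_eq0.
by move=> ->; rewrite /normsq/= expr0n/= addr0.
Qed.

Lemma L2_norm_ltE u (e : R) : 0 < e -> (`|u| < e%:C) = (nsq u < e ^+ 2).
Proof.
move=> e0; rewrite L2_normE L2dotuu.
rewrite -[LHS]ltr_sqr ?nnegrE ?sqrtC_ge0 ?lecR ?nsq_ge0 ?(ltW e0)//.
by rewrite sqrtCK -[X in _ < X]rmorphXn/= ltcR.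
Qed.

(** Translates the topology of L^2, whose balls have radii in R[i], into real
    estimates. *)
Lemma closure_nsqP M u :
  closure M u <-> forall e : R, 0 < e -> exists2 v, M v & nsq (v - u) < e.
Proof.
split=> [Mu e e0|Mu B /nbhs_ballP[r /= r0 rB]].
  have nB : nbhs u (ball u (Num.sqrt e)%:C).
    by apply: nbhsx_ballx; rewrite ltcR sqrtr_gt0.
  have [v [Mv]] := Mu _ nB.
  rewrite -ball_normE/= L2_norm_ltE ?sqrtr_gt0// sqr_sqrtr ?(ltW e0)// nsqBC.
  by move=> ?; exists v.
have [r' r'0 rE] : exists2 r' : R, 0 < r' & r = r'%:C.
  move: r0; rewrite ltcE/= => /andP[/eqP Im0 Re0].
  by exists (complex.Re r) => //; case: r Im0 Re0 {rB} => a b /= ->.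
have [v Mv vu] := Mu (r' ^+ 2) (exprn_gt0 _ r'0).
exists v; split => //; apply: rB.
by rewrite -ball_normE/= rE L2_norm_ltE// nsqBC.
Qed.

Lemma dense_closureP M : dense M <-> forall u, closure M u.
Proof.
split=> [Md u B|cM W [u Wu] oW].
  rewrite nbhsE => -[W [oW Wu] WB].
  by have [|v [Ov Mv]] := Md W _ oW; [exists u|exists v; split => //; exact: WB].
by have [|v [Mv Ov]] := cM u W; [exact: open_nbhs_nbhs|exists v].
Qed.

Lemma orthc_closure M u :
  orthc (L2dot mu) M u -> orthc (L2dot mu) (closure M) u.
Proof.
move=> Mu v /closure_nsqP cv.
suff uv0 : L2dot mu u v = 0 by [].
apply: normsq_eq0; apply/eqP.
rewrite eq_le normsq_ge0 andbT; apply/ler_addgt0Pr => e e0; rewrite add0r.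
have u1 : 0 < nsq u + 1 by rewrite ltr_wpDl ?nsq_ge0.
have [m Mm mv] := cv (e / (nsq u + 1)) (divr_gt0 e0 u1).
have um : L2dot mu u m = 0 by exact: Mu.
have -> : L2dot mu u v = L2dot mu u (v - m) by rewrite L2dotBr um subr0.
apply: le_trans (L2_cauchy_schwarz _ _) _; rewrite nsqBC.
apply: (@le_trans _ _ ((nsq u + 1) * nsq (m - v))).
  by rewrite ler_wpM2r ?nsq_ge0// lerDl.
by rewrite mulrC -ler_pdivlMr// ltW.
Qed.

Lemma orthc_self M u : M u -> orthc (L2dot mu) M u -> u = 0.
Proof. by move=> Mu /(_ _ Mu) uu; apply: nsq_eq0; rewrite /nsq [X in complex.Re X]uu. Qed.

End L2geometry.


(** * Sequences with geometrically decaying increments *)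
Section fast_sequences.
Context (R : realType).
Local Open Scope ereal_scope.

(** The partial sums are bounded by 2 - (3/2) 4^(-n). *)
Lemma nneseries_geometric4_lty : \sum_(n <oo) ((4^-1 ^+ n)%:E : \bar R) < +oo.
Proof.
apply: (@le_lt_trans _ _ 2%:E); last exact: ltry.
apply: lime_le; first by apply: is_cvg_nneseries => n _ _; rewrite lee_fin exprn_ge0.
apply: nearW => n; rewrite sumEFin lee_fin.
suff : (\sum_(0 <= i < n) 4^-1 ^+ i <= 2 - (3/2) * 4^-1 ^+ n :> R)%R.
  have : (0 <= 4^-1 ^+ n :> R)%R by rewrite exprn_ge0.
  move: (4^-1 ^+ n)%R => t; lra.
elim: n => [|n IH]; first by rewrite big_geq// expr0; lra.
rewrite big_nat_recr//= exprS.
have : (0 <= 4^-1 ^+ n :> R)%R by rewrite exprn_ge0.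
by move: (4^-1 ^+ n)%R IH => t; lra.
Qed.

Lemma norm_le_geometric (x C : R) n :
  (x ^+ 2 <= C * 4^-1 ^+ n -> `|x| <= geometric (Num.sqrt C) 2^-1 n)%R.
Proof.
move=> xC.
have C0 : (0 <= C)%R.
  have := le_trans (sqr_ge0 x) xC.
  by rewrite pmulr_lge0// exprn_gt0.
rewrite -ler_sqr ?nnegrE//; last first.
  by apply: mulr_ge0; [exact: sqrtr_ge0|exact: exprn_ge0].
rewrite real_normK ?num_real// /geometric/= exprMn sqr_sqrtr//.
by rewrite -exprM mulnC exprM exprVn (_ : (2 ^+ 2 = 4 :> R)%R)//; lra.
Qed.

Lemma cvg0_fast (a : nat -> R) (C : R) :
  (forall n, a n ^+ 2 <= C * 4^-1 ^+ n)%R -> a n @[n --> \oo] --> 0%R.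
Proof.
move=> aC; have gC : geometric (Num.sqrt C) 2^-1 n @[n --> \oo] --> (0%R : R).
  by apply: cvg_geometric; rewrite ger0_norm; lra.
apply: norm_cvg0; apply: (squeeze_cvgr _ (cvg_cst 0%R) gC).
by apply: nearW => n; rewrite normr_ge0 norm_le_geometric.
Qed.

Lemma is_cvg_fast (a : nat -> R) (C : R) :
  (forall n, (a n.+1 - a n) ^+ 2 <= C * 4^-1 ^+ n)%R -> cvgn a.
Proof.
move=> aC.
have cs : cvgn (series (telescope a)).
  apply: (@normed_cvg _ R^o).
  apply: (@series_le_cvg _ _ (geometric (Num.sqrt C) 2^-1)) => [n|n|n|].
  - exact: normr_ge0.
  - by apply: mulr_ge0; [exact: sqrtr_ge0|exact: exprn_ge0].
  - exact/norm_le_geometric/aC.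
  - by apply: is_cvg_geometric_series; rewrite ger0_norm//; lra.
have -> : a = (fun n => a 0%N + series (telescope a) n)%R.
  by apply/funext => n; exact: eq_sum_telescope.
by apply: is_cvgD; first exact: is_cvg_cst.
Qed.

Lemma limn_einf_le_bound (u : (\bar R)^nat) (B : \bar R) N :
  (forall k, (N <= k)%N -> u k <= B) -> limn_einf u <= B.
Proof.
move=> uB; rewrite limn_einf_lim; apply: lime_le; first exact: is_cvg_einfs.
apply: nearW => n; apply: le_trans (uB (maxn n N) (leq_maxr _ _)).
by apply: ereal_inf_lbound; exists (maxn n N) => //=; rewrite leq_maxl.
Qed.

Context d (X : measurableType d).

(** A total measurable function that agrees with the pointwise limit wherever
    that limit exists. *)
Definition limsup_fun (g : nat -> X -> R) x : R :=
  fine (limn_esup (fun n => (g n x)%:E)).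

Lemma measurable_limsup_fun g : (forall n, measurable_fun setT (g n)) ->
  measurable_fun setT (limsup_fun g).
Proof.
move=> mg.
apply: (@measurableT_comp _ _ _ _ _ _ fine _ (fun x => limn_esup (fun n => (g n x)%:E))).
  exact: fine_measurable.
by apply: measurable_fun_limn_esup => n; apply/measurable_EFinP.
Qed.

Lemma limsup_fun_cvg g x (l : R) : g n x @[n --> \oo] --> l -> limsup_fun g x = l.
Proof.
move=> gl; rewrite /limsup_fun.
have gE : (g n x)%:E @[n --> \oo] --> l%:E by apply: cvg_EFin; first exact: nearW.
by have [_ ->] := cvg_limn_einf_sup gE.
Qed.

End fast_sequences.

(** * Completeness of L^2 *)
Section L2complete.
Context d (X : measurableType d) (R : realType) (mu : {measure set X -> \bar R}).
Implicit Types (u v f : L2 mu) (a : R[i]) (M : set (L2 mu)).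

Lemma L2_addE u v : \forall x \ae mu, (u + v : L2 mu) x = u x + v x.
Proof.
by have := L2_reprP (repr u + repr v); rewrite L2clsD !reprK_L2.
Qed.

Lemma L2_scaleE a u : \forall x \ae mu, (a *: u : L2 mu) x = a * u x.
Proof. by have := L2_reprP (a *: repr u); rewrite L2clsZ reprK_L2. Qed.

Lemma L2_subE u v : \forall x \ae mu, (u - v : L2 mu) x = u x - v x.
Proof.
rewrite -scaleN1r; have := L2_addE u (-1 *: v); have := L2_scaleE (-1) v.
by apply: filterS2 => x vE ->; rewrite vE mulN1r.
Qed.

Lemma cmeasurable_L2 u : cmeasurable u.
Proof. by case: (L2funP (repr u)). Qed.

Lemma measurable_L2_normsq u : measurable_fun setT (fun x => (normsq (u x))%:E).
Proof. exact/measurable_EFinP/measurable_normsq/cmeasurable_L2. Qed.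

Lemma cmeasurableB (f g : X -> R[i]) : cmeasurable f -> cmeasurable g ->
  cmeasurable (fun x => f x - g x).
Proof.
move=> mf mg; have -> : (fun x => f x - g x) = (fun x => f x + cst (-1) x * g x).
  by apply/funext => x; rewrite mulN1r.
exact: cmeasurableD mf (cmeasurableM (cmeasurable_cst _ _) mg).
Qed.

(** The series of the 4^n |v n|^2 has a finite integral, hence is finite almost
    everywhere, and bounds each of its terms.  This replaces the extraction of
    an almost everywhere convergent subsequence. *)
Lemma ae_fast_bound (v : nat -> L2 mu) : (forall n, nsq (v n) <= 16^-1 ^+ n) ->
  \forall x \ae mu, exists C, forall n, normsq (v n x) <= C * 4^-1 ^+ n.
Proof.
move=> v16.
pose F n x : \bar R := ((4 ^+ n) * normsq (v n x))%:E.
have F0 n x : (0 <= F n x)%E by rewrite lee_fin mulr_ge0 ?normsq_ge0 ?exprn_ge0.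
have mF n : measurable_fun setT (F n).
  apply/measurable_EFinP; apply: measurable_funM => //.
  exact/measurable_normsq/cmeasurable_L2.
have IF : (\int[mu]_x (\sum_(n <oo) F n x) < +oo)%E.
  rewrite integral_nneseries//; apply: le_lt_trans (nneseries_geometric4_lty R).
  apply: lee_nneseries => [n _ _|n _]; first exact: integral_ge0.
  rewrite /F; under eq_integral do rewrite EFinM.
  rewrite ge0_integralZl ?lee_fin ?exprn_ge0//; last 2 first.
  - exact: measurable_L2_normsq.
  - by move=> x _; rewrite lee_fin normsq_ge0.
  rewrite -nsq_integral -EFinM lee_fin.
  apply: le_trans (ler_wpM2l _ (v16 n)) _; first exact: exprn_ge0.
  by rewrite -exprMn (_ : 4 * 16^-1 = 4^-1 :> R)//; lra.
have : mu.-integrable setT (fun x => \sum_(n <oo) F n x)%E.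
  apply/integrableP; split; first exact: ge0_emeasurable_sum.
  by under eq_integral do rewrite gee0_abs ?nneseries_ge0//.
move/(integrable_ae measurableT); apply: filterS => x /(_ I) Sfin.
exists (fine (\sum_(n <oo) F n x)) => n.
rewrite exprVn ler_pdivlMr ?exprn_gt0// mulrC.
rewrite -lee_fin fineK//.
apply: le_trans (nneseries_lim_ge n.+1 (fun m _ _ => F0 m x)).
by rewrite big_nat_recr//= leeDr// sume_ge0.
Qed.

(** The bound C 16^(-n) survives the recursion
    nsq (u (n + m.+1) - u n) <= 2 C 16^(-n-1) + 2 16^(-n) as soon as
    C >= 16 / 7. *)
Lemma nsq_fast_cauchy (u : nat -> L2 mu) :
  (forall n, nsq (u n.+1 - u n) <= 16^-1 ^+ n) ->
  forall m n, nsq (u (n + m)%N - u n) <= 4 * 16^-1 ^+ n.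
Proof.
move=> u16; elim=> [|m IH] n.
  by rewrite addn0 subrr /nsq linear0l/= mulr_ge0 ?exprn_ge0.
rewrite addnS -addSn -(subrKA (u n.+1)).
apply: le_trans (nsqD_le _ _) _.
have := u16 n; have := IH n.+1; rewrite exprS.
have : 0 <= 16^-1 ^+ n :> R by rewrite exprn_ge0.
move: (16^-1 ^+ n) (nsq _) (nsq _) => t p q; lra.
Qed.

(** Riesz-Fischer.  The sequence converges almost everywhere by ae_fast_bound,
    and Fatou's lemma bounds the distance of u n to the pointwise limit. *)
Lemma L2_complete (u : nat -> L2 mu) :
  (forall n, nsq (u n.+1 - u n) <= 16^-1 ^+ n) ->
  exists l, forall n, nsq (l - u n) <= 4 * 16^-1 ^+ n.
Proof.
move=> u16.
pose l0 x := limsup_fun (fun n x => complex.Re (u n x)) x +i*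
             limsup_fun (fun n x => complex.Im (u n x)) x.
have ml0 : cmeasurable l0.
  by split; apply: measurable_limsup_fun => n; case: (cmeasurable_L2 (u n)).
have cvgl0 : \forall x \ae mu,
    complex.Re (u n x) @[n --> \oo] --> complex.Re (l0 x) /\
    complex.Im (u n x) @[n --> \oo] --> complex.Im (l0 x).
  have : \forall x \ae mu, forall n, (u n.+1 - u n : L2 mu) x = u n.+1 x - u n x.
    by apply: ae_foralln => n; exact: L2_subE.
  apply: filterS2 (ae_fast_bound u16) => x [C uC] uE.
  have [cRe cIm] : cvgn (fun n => complex.Re (u n x)) /\
                   cvgn (fun n => complex.Im (u n x)).
    split; apply: (@is_cvg_fast _ _ C) => n; apply: le_trans (uC n);
      rewrite uE; case: (u n.+1 x) => a b; case: (u n x) => a' b';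
      by rewrite /normsq/= ?lerDl ?lerDr sqr_ge0.
  by rewrite /l0/= (limsup_fun_cvg cRe) (limsup_fun_cvg cIm).
have l0_le n : (\int[mu]_x (normsq (l0 x - u n x))%:E <= (4 * 16^-1 ^+ n)%:E)%E.
  pose g k x : \bar R := (normsq (u k x - u n x))%:E.
  have g0 k x : setT x -> (0 <= g k x)%E by rewrite lee_fin normsq_ge0.
  have mg k : measurable_fun setT (g k).
    apply/measurable_EFinP/measurable_normsq.
    by apply: cmeasurableB => //; exact: cmeasurable_L2.
  have gE : \forall x \ae mu, limn_einf (g ^~ x) = (normsq (l0 x - u n x))%:E.
    apply: filterS cvgl0 => x [cRe cIm].
    have : g k x @[k --> \oo] --> (normsq (l0 x - u n x))%:E.
      apply: cvg_EFin; first exact: nearW.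
      pose re k := complex.Re (u k x) - complex.Re (u n x).
      pose im k := complex.Im (u k x) - complex.Im (u n x).
      have -> : fine \o (fun k => g k x) = (fun k => re k * re k + im k * im k).
        apply/funext => k; rewrite /g/= /normsq /re /im.
        by case: (u k x) => a b; case: (u n x) => a' b' /=; rewrite !expr2.
      have -> : normsq (l0 x - u n x) =
          (complex.Re (l0 x) - complex.Re (u n x)) ^+ 2 +
          (complex.Im (l0 x) - complex.Im (u n x)) ^+ 2.
        by rewrite /normsq; case: (l0 x) => a b; case: (u n x).
      by rewrite !expr2; apply: cvgD; apply: cvgM; apply: cvgB => //; exact: cvg_cst.
    by move/cvg_limn_einf_sup => [].
  have -> : (\int[mu]_x (normsq (l0 x - u n x))%:E =
             \int[mu]_x limn_einf (g ^~ x))%E.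
    apply: ae_eq_integral => //.
    - apply/measurable_EFinP/measurable_normsq.
      by apply: cmeasurableB => //; exact: cmeasurable_L2.
    - rewrite /limn_einf; apply: measurableT_comp => //.
      apply: (@measurable_fun_limn_esup _ _ _ _ (fun k x => - g k x)%E) => k.
      exact: measurableT_comp.
    - by apply: filterS gE => x -> _.
  apply: le_trans (fatou mu measurableT mg g0) _.
  apply: (@limn_einf_le_bound _ _ _ n) => k nk.
  apply: (@le_trans _ _ (nsq (u (n + (k - n))%N - u n))%:E); last first.
    by rewrite lee_fin; exact: (nsq_fast_cauchy u16 (k - n)).
  rewrite nsq_integral le_eqVlt; apply/orP; left; apply/eqP.
  apply: ae_eq_integral => //; first exact: measurable_L2_normsq.
  have := L2_subE (u (n + (k - n))%N) (u n); apply: filterS => x -> _.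
  by rewrite subnKC.
have Ld : (fun x => l0 x - u 0%N x) \in L2pred mu.
  apply/L2predP; split; last by apply: le_lt_trans (l0_le 0%N) _; exact: ltry.
  by apply: cmeasurableB => //; exact: cmeasurable_L2.
exists (L2cls (MkL2fun Ld) + u 0%N) => n.
rewrite -lee_fin nsq_integral; apply: le_trans (l0_le n).
rewrite le_eqVlt; apply/orP; left; apply/eqP.
apply: ae_eq_integral => //.
- exact: measurable_L2_normsq.
- apply/measurable_EFinP/measurable_normsq.
  by apply: cmeasurableB => //; exact: cmeasurable_L2.
have A1 := L2_subE (L2cls (MkL2fun Ld) + u 0%N) (u n).
have A2 := L2_addE (L2cls (MkL2fun Ld)) (u 0%N).
have A3 := L2_reprP (MkL2fun Ld).
apply: filterS3 A1 A2 A3 => x -> -> -> _ /=.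
by rewrite subrK.
Qed.

End L2complete.


(** * Orthogonal projections *)
Section projection.
Context d (X : measurableType d) (R : realType) (mu : {measure set X -> \bar R}).
Implicit Types (u v f : L2 mu) (a : R[i]) (M : set (L2 mu)).

Lemma le0_geometric (q r C : R) : 0 <= q < 1 ->
  (forall n, r <= C * q ^+ n) -> r <= 0.
Proof.
move=> /andP[q0 q1] rC; have c0 : geometric C q n @[n --> \oo] --> 0.
  by apply: cvg_geometric; rewrite ger0_norm.
rewrite -(cvg_lim (@Rhausdorff R) c0); apply: limr_ge; first by apply/cvg_ex; exists 0.
exact: nearW.
Qed.

Definition linear_set M := M 0 /\ forall a u v, M u -> M v -> M (a *: u + v).

(** The vector subtracted from u is its projection onto the line through v. *)
Lemma nsq_subZ_dot u v : nsq v != 0 ->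
  nsq (u - (L2dot mu u v * ((nsq v)^-1)%:C) *: v) =
  nsq u - normsq (L2dot mu u v) / nsq v.
Proof.
move=> v0; rewrite nsqD nsqN nsqZ -scaleNr L2dotZr.
case: (L2dot mu u v) => p q; rewrite /normsq/=; field.
exact: v0.
Qed.

(** Otherwise moving m along v, by the projection of f - m onto the line through
    v, would bring it closer to f than dmin. *)
Lemma normsq_dot_near_minimizer M f m v (dmin e : R) : linear_set M ->
  (forall m', M m' -> dmin <= nsq (f - m')) -> M m -> nsq (f - m) < dmin + e ->
  M v -> normsq (L2dot mu (f - m) v) <= e * nsq v.
Proof.
move=> [_ lM] minM Mm fm Mv.
have [v0|v0] := eqVneq (nsq v) 0.
  by have := L2_cauchy_schwarz (f - m) v; rewrite v0 !mulr0.
have vgt : 0 < nsq v by rewrite lt_neqAle eq_sym v0 nsq_ge0.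
pose t := L2dot mu (f - m) v * ((nsq v)^-1)%:C.
have := minM (t *: v + m) (lM _ _ _ Mv Mm).
have -> : f - (t *: v + m) = (f - m) - t *: v by rewrite opprD addrA addrAC.
rewrite nsq_subZ_dot// => h.
rewrite -ler_pdivrMr//; move: fm h; move: (_ / _) (nsq _) => p q; lra.
Qed.

(** A minimizing sequence for the distance from f to M is Cauchy by the
    parallelogram law; its limit p is the projection, and f - p is orthogonal to
    M as a limit of the f - m n, which are nearly so. *)
Lemma L2_projection M f : linear_set M ->
  exists p q, [/\ closure M p, orthc (L2dot mu) M q & f = p + q].
Proof.
move=> linM; have [M0 lM] := linM.
pose E := [set nsq (f - m) | m in M].
have infE : has_inf E.
  split; first by exists (nsq (f - 0)); exists 0.
  by exists 0 => _ [m _ <-]; exact: nsq_ge0.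
have minM m : M m -> inf E <= nsq (f - m).
  by move=> Mm; apply: ge_inf; [case: infE|exists m].
have pow0 n : 0 < 16^-1 ^+ n :> R by rewrite exprn_gt0.
have near n : exists m, M m /\ nsq (f - m) < inf E + 16^-1 ^+ n / 4.
  have [|_ [m Mm <-] lt] := @inf_adherent _ E (16^-1 ^+ n / 4) _ infE.
    by rewrite divr_gt0.
  by exists m.
have [m /all_and2[Mm mE]] := choice near.
have fast n : nsq (m n.+1 - m n) <= 16^-1 ^+ n.
  (* the midpoint of m n and m n.+1, at distance at least that of M *)
  pose c := (2^-1 : R[i]) *: m n + (2^-1 *: m n.+1 + 0).
  have Mc : M c by do 2 apply: (lM) => //.
  have := L2_parallelogram (f - m n) (f - m n.+1).
  have -> : (f - m n) - (f - m n.+1) = m n.+1 - m n.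
    by rewrite opprB addrC addrA subrK.
  have -> : f - m n + (f - m n.+1) = 2 *: (f - c).
    rewrite /c addr0 scalerBr scalerDr !scalerA divff ?pnatr_eq0// !scale1r.
    by rewrite scaler_nat mulr2n opprD addrACA.
  rewrite nsqZ (_ : normsq 2 = 4); last by rewrite /normsq/=; ring.
  have := minM _ Mc; have := mE n; have := mE n.+1; rewrite exprS.
  have := pow0 n; move: (16^-1 ^+ n) => e.
  move: (inf E) (nsq (f - c)) (nsq (f - m n)) (nsq (f - m n.+1)) => *; lra.
have [l ml] := L2_complete fast.
have lM' : closure M l.
  apply/closure_nsqP => e e0.
  have [n en] : exists n, 4 * 16^-1 ^+ n < e.
    apply: contrapT => /forallNP ne.
    have : e <= 0; last by rewrite leNgt e0.
    apply: (@le0_geometric 16^-1 _ 4) => [|n]; first by lra.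
    by rewrite leNgt; apply/negP/ne.
  by exists (m n) => //; rewrite nsqBC; apply: le_lt_trans (ml n) en.
exists l, (f - l); split; [exact: lM'| |by rewrite addrC subrK].
move=> v Mv; suff h : L2dot mu (f - l) v = 0 by [].
apply: normsq_eq0; apply/eqP; rewrite eq_le normsq_ge0 andbT.
apply: (@le0_geometric 16^-1 _ (9 * nsq v)) => [|n]; first by lra.
have -> : f - l = (f - m n) + (m n - l) by rewrite addrA subrK.
rewrite L2dotDl; apply: le_trans (normsqD_le _ _) _.
have := normsq_dot_near_minimizer linM minM (Mm n) (mE n) Mv.
have := L2_cauchy_schwarz (m n - l) v.
have : nsq (m n - l) * nsq v <= 4 * 16^-1 ^+ n * nsq v.
  by rewrite ler_wpM2r ?nsq_ge0// nsqBC.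
have := mulr_ge0 (ltW (pow0 n)) (nsq_ge0 v).
set A := normsq (L2dot mu (f - m n) v); set B := normsq (L2dot mu (m n - l) v).
set P := nsq (m n - l) * nsq v; move: A B P (nsq v) (16^-1 ^+ n) => A B P s e.
nra.
Qed.

(** The component of u orthogonal to M is orthogonal to u, hence vanishes. *)
Lemma orthc_orthc_closure M u : linear_set M ->
  orthc (L2dot mu) (orthc (L2dot mu) M) u -> closure M u.
Proof.
move=> linM Mu; have [p [q [Mp Mq uE]]] := L2_projection u linM.
have qu : L2dot mu u q = 0 by exact: Mu.
have qp : L2dot mu p q = 0 by apply: L2dot_eq0C; exact: (orthc_closure Mq).
have q0 : q = 0.
  by apply: nsq_eq0; move: qu; rewrite uE L2dotDl qp add0r /nsq => ->.
by rewrite uE q0 addr0.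
Qed.

(** The rate 16^(-n) is the one that yields almost everywhere convergence in
    ae_fast_bound. *)
Lemma closure_fast_seq M u : closure M u ->
  exists s, forall n, M (s n) /\ nsq (s n - u) <= 16^-1 ^+ n.
Proof.
move=> /closure_nsqP cu.
have near n : exists v, M v /\ nsq (v - u) <= 16^-1 ^+ n.
  have [|v Mv /ltW vu] := cu (16^-1 ^+ n); first by rewrite exprn_gt0.
  by exists v.
by have [s sP] := choice near; exists s.
Qed.

End projection.

(** * The graph of a reciprocal *)
Section reciprocal_graph.
Context d (X : measurableType d) (R : realType) (mu : {measure set X -> \bar R}).
Implicit Types (u v f k h : L2 mu) (a : R[i]) (T S : poperator (L2 mu)).

Lemma poperator_ext T S : (forall f k, T f = Some k <-> S f = Some k) -> T = S.
Proof.
move=> TS; apply/funext => f; case TE : (T f) => [k|]; case SE : (S f) => [k'|] //.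
- by rewrite -SE; apply/esym/TS.
- by rewrite -SE; apply/esym/TS.
- by rewrite -TE; apply/TS.
Qed.

Lemma linear_op_sub T f g u v : linear_op T -> T f = Some u -> T g = Some v ->
  T (f - g) = Some (u - v).
Proof.
move=> [_ lT] Tf Tg; have := lT (-1) _ _ _ _ Tg Tf.
by rewrite !scaleN1r [in - g + f]addrC [in - v + u]addrC.
Qed.

Lemma linear_set_ran T : linear_op T -> linear_set (ran T).
Proof.
move=> [T0 lT]; split; first by exists 0.
by move=> a u v [f Tf] [g Tg]; exists (a *: f + g); exact: lT.
Qed.

Lemma linear_set_ker T : linear_op T -> linear_set (ker T).
Proof.
move=> [T0 lT]; split => // a f g Tf Tg; rewrite /ker/=.
by rewrite (lT _ _ _ _ _ Tf Tg) scaler0 addr0.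
Qed.

(** The intended graph of the reciprocal of T. *)
Definition reciprocal_rel T f k := exists u h,
  [/\ T k = Some u, orthc (L2dot mu) (ker T) k, orthc (L2dot mu) (ran T) h
    & f = u + h].

Lemma orthc0 (M : set (L2 mu)) : orthc (L2dot mu) M 0.
Proof. by move=> v _; exact: (linear0l (L2dot mu)). Qed.

Lemma orthc_linear (M : set (L2 mu)) a u v : orthc (L2dot mu) M u ->
  orthc (L2dot mu) M v -> orthc (L2dot mu) M (a *: u + v).
Proof.
move=> Mu Mv g Mg; suff : L2dot mu (a *: u + v) g = 0 by [].
have ug : L2dot mu u g = 0 by exact: Mu.
have vg : L2dot mu v g = 0 by exact: Mv.
by rewrite L2dotDl L2dotZl ug vg mulr0 addr0.
Qed.

Section closed_kernel.
Variable T : poperator (L2 mu).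
Hypotheses (lT : linear_op T) (cT : closure (ker T) `<=` ker T).

(** The difference of the two range components lies in the range and in its
    orthogonal complement, so it vanishes; then k - k' is in the kernel and
    orthogonal to it. *)
Lemma reciprocal_rel_fun f k k' :
  reciprocal_rel T f k -> reciprocal_rel T f k' -> k = k'.
Proof.
move=> [u [h [Tk kk hh fE]]] [u' [h' [Tk' kk' hh' fE']]].
have Tkk' := linear_op_sub lT Tk Tk'.
have uh : u - u' = h' - h.
  by apply/eqP; rewrite subr_eq addrAC eq_sym subr_eq -fE fE' addrC.
have u0 : u - u' = 0.
  apply: (@orthc_self _ _ _ _ (ran T)); first by exists (k - k').
  by rewrite uh; exact: orthcB.
apply/eqP; rewrite -subr_eq0; apply/eqP.
apply: (@orthc_self _ _ _ _ (ker T)); last exact: orthcB.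
by rewrite /ker/= Tkk' u0.
Qed.

(** Closedness of the kernel enters here: the projection of g onto the closure
    of the kernel has to be annihilated by T. *)
Lemma ker_decomposition g u : T g = Some u ->
  exists k n, [/\ T k = Some u, orthc (L2dot mu) (ker T) k, ker T n & g = k + n].
Proof.
move=> Tg; have [n [k [/cT Tn kk gE]]] := L2_projection g (linear_set_ker lT).
exists k, n; split => //; last by rewrite addrC.
have -> : k = g - n by rewrite gE addrAC subrr add0r.
by rewrite -[u]subr0; exact: linear_op_sub.
Qed.

Let S f := if pselect (exists k, reciprocal_rel T f k) is left e
  then Some (sval (cid e)) else None.

Let SP f k : S f = Some k <-> reciprocal_rel T f k.
Proof.
rewrite /S; case: pselect => [e|ne].
  split=> [[<-]|fk]; first by case: cid.
  by congr Some; case: cid => k' /= fk'; exact: reciprocal_rel_fun fk' fk.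
by split => // fk; exfalso; apply: ne; exists k.
Qed.

Let domS f : dom S f <-> exists k, S f = Some k.
Proof.
rewrite /dom/=; case: (S f) => [k|]; first by split => // _; exists k.
by split => // -[].
Qed.

(** The relation reciprocal_rel is the graph of an operator, and this operator
    has all the defining properties of a reciprocal. *)
Lemma is_reciprocal_closed_kernel : exists S,
  is_reciprocal (L2dot mu) T S /\ forall f k, S f = Some k <-> reciprocal_rel T f k.
Proof.
have SE u h g : T g = Some u -> orthc (L2dot mu) (ran T) h ->
    exists k n, [/\ S (u + h) = Some k, T k = Some u,
      orthc (L2dot mu) (ker T) k, ker T n & g = k + n].
  move=> /ker_decomposition[k [n [Tk kk nn gE]]] hh.
  by exists k, n; split => //; apply/SP; exists u, h.
exists S; split; last exact: SP.
have domE : dom S = [set f + g | f in ran T & g in orthc (L2dot mu) (ran T)].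
  apply/seteqP; split => [f /domS[k /SP[u [h [Tk kk hh ->]]]]|].
    by exists u; [exists k|exists h].
  move=> _ [u [g Tg] [h hh <-]]; apply/domS.
  by have [k [n [? _ _ _ _]]] := SE _ _ _ Tg hh; exists k.
split.
- split.
    apply/SP; exists 0, 0.
    by split; [case: lT|exact: orthc0|exact: orthc0|rewrite addr0].
  move=> a f g k l /SP[u [h [Tk kk hh ->]]] /SP[v [h' [Tl kl hh' ->]]].
  apply/SP; exists (a *: u + v), (a *: h + h'); split.
  + by case: lT => _; exact.
  + exact: orthc_linear.
  + exact: orthc_linear.
  + by rewrite scalerDr addrACA.
- apply/dense_closureP => f.
  have [p [q [/closure_nsqP cp rq ->]]] := L2_projection f (linear_set_ran lT).
  apply/closure_nsqP => e e0; have [v Rv vp] := cp e e0.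
  exists (v + q); first by rewrite domE; exists v => //; exists q.
  by rewrite opprD addrACA subrr addr0.
- exact: domE.
- move=> f /domS[k Sf]; have /SP[u [h [Tk kk hh fE]]] := Sf.
  exists u; first by rewrite /op_comp Sf.
  split; first by apply: subset_closure; exists k.
  by rewrite fE addrAC subrr add0r; exact: orthc_closure.
- move=> g; rewrite /dom/=; case Tg : (T g) => [u|//] _.
  have [k [n [+ Tk kk nn gE]]] := SE _ _ _ Tg (@orthc0 (ran T)).
  rewrite addr0 => Sk.
  exists k; first by rewrite /op_comp Tg.
  split => // v vk; rewrite gE addrAC subrr add0r.
  by suff : L2dot mu n v = 0 by []; apply: L2dot_eq0C; exact: vk.
- apply/seteqP; split => [f /SP[u [h [T0 _ hh ->]]]|h hh].
    by case: lT => T00 _; move: T0; rewrite T00 => -[<-]; rewrite add0r.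
  apply/SP; exists 0, h.
  by split; [case: lT|exact: orthc0|exact: hh|rewrite add0r].
Qed.

Lemma reciprocalP f k :
  reciprocal (L2dot mu) T f = Some k <-> reciprocal_rel T f k.
Proof.
have [S' [recS SP']] := is_reciprocal_closed_kernel.
have -> : reciprocal (L2dot mu) T = S'.
  by apply: xget_unique => // S'' recS''; exact: is_reciprocal_unique recS'' recS.
exact: SP'.
Qed.

End closed_kernel.

End reciprocal_graph.


(** * Classes of functions as elements of L^2 *)
Section classes.
Context d (X : measurableType d) (R : realType) (mu : {measure set X -> \bar R}).
Implicit Types (u v g : L2 mu) (a : R[i]).

(** Membership of a weighted composition operator graph reduces through this to
    a pointwise identity almost everywhere. *)
Lemma L2classP (f : X -> R[i]) u : cmeasurable f ->
  L2class mu f = Some u <-> \forall x \ae mu, u x = f x.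
Proof.
move=> mf; split.
  by rewrite /L2class; case: insubP => //= f' _ ff' [<-]; rewrite -ff'; exact: L2_reprP.
move=> uf; rewrite (@ae_eq_L2class _ _ _ mu f u)//; last 2 first.
- exact: cmeasurable_L2.
- by apply: filterS uf => x ->.
by rewrite /L2class /L2_to_fun valK/= reprK_L2.
Qed.

Lemma L2_zeroE : \forall x \ae mu, (0 : L2 mu) x = 0.
Proof. by have := L2_reprP (0 : L2fun mu); rewrite L2cls0. Qed.

Lemma L2_dominated (k : X -> R[i]) (C : R) g : cmeasurable k ->
  (\forall x \ae mu, normsq (k x) <= C * normsq (g x)) ->
  exists u, \forall x \ae mu, u x = k x.
Proof.
move=> mk kg.
have mCg : measurable_fun setT (fun x => (`|C| * normsq (g x))%:E).
  apply/measurable_EFinP; apply: measurable_funM => //.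
  exact/measurable_normsq/cmeasurable_L2.
suff Lk : k \in L2pred mu.
  by exists (L2cls (MkL2fun Lk)); exact: L2_reprP.
apply/L2predP; split => //.
apply: (@le_lt_trans _ _ (\int[mu]_x (`|C| * normsq (g x))%:E)%E).
  apply: ae_ge0_le_integral => //.
  - by move=> x _; rewrite lee_fin normsq_ge0.
  - exact/measurable_EFinP/measurable_normsq.
  - by move=> x _; rewrite lee_fin mulr_ge0 ?normsq_ge0.
  - apply: filterS kg => x kx _; rewrite lee_fin; apply: le_trans kx _.
    by rewrite ler_wpM2r ?normsq_ge0// ler_norm.
under eq_integral do rewrite EFinM.
rewrite ge0_integralZl ?lee_fin//; last 2 first.
- exact: measurable_L2_normsq.
- by move=> x _; rewrite lee_fin normsq_ge0.
by rewrite -nsq_integral -EFinM ltry.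
Qed.

Lemma nsq_le_ae (C : R) u v :
  (\forall x \ae mu, normsq (u x) <= C * normsq (v x)) -> 0 <= C ->
  nsq u <= C * nsq v.
Proof.
move=> uv C0; rewrite -lee_fin EFinM !nsq_integral -ge0_integralZl ?lee_fin//; last 2 first.
- exact: measurable_L2_normsq.
- by move=> x _; rewrite lee_fin normsq_ge0.
apply: ae_ge0_le_integral => //.
- by move=> x _; rewrite lee_fin normsq_ge0.
- exact: measurable_L2_normsq.
- by move=> x _; rewrite -EFinM lee_fin mulr_ge0 ?normsq_ge0.
- under eq_fun do rewrite -EFinM.
  by apply/measurable_EFinP/measurable_funM => //; exact/measurable_normsq/cmeasurable_L2.
- by apply: filterS uv => x uvx _; rewrite -EFinM lee_fin.
Qed.

(** Obtained from the measurability of real powers, as x^-1 is the power -1 of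
    a nonnegative x, also for x = 0. *)
Lemma measurable_inv_real (f : X -> R) : measurable_fun setT f ->
  (forall x, 0 <= f x) -> measurable_fun setT (fun x => (f x)^-1).
Proof.
move=> mf f0; have -> : (fun x => (f x)^-1) = (@powR R ^~ (-1)) \o f.
  by apply/funext => x /=; rewrite powR_inv1.
by apply: measurableT_comp => //; exact: measurable_powR.
Qed.

Lemma cmeasurable_real (f : X -> R) : measurable_fun setT f ->
  cmeasurable (fun x => (f x)%:C).
Proof. by move=> mf; split; [exact: mf|exact: measurable_cst]. Qed.

Lemma invc_normsq (z : R[i]) : z^-1 = z^* * ((normsq z)^-1)%:C.
Proof.
have [->|z0] := eqVneq z 0; first by rewrite invr0 rmorph0 mul0r.
have n0 : (normsq z)%:C != 0 :> R[i].
  by apply: contra z0 => /eqP/eqP; rewrite eq_complex/= eqxx andbT => /eqP/normsq_eq0 ->.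
apply: (mulfI z0); rewrite divff// mulrA normsq_conj.
by rewrite -rmorphM/= divff//; apply: contra n0 => /eqP ->.
Qed.

Lemma cmeasurable_inv (f : X -> R[i]) : cmeasurable f ->
  cmeasurable (fun x => (f x)^-1).
Proof.
move=> mf; rewrite (_ : (fun x => _) = (fun x => (f x)^* * ((normsq (f x))^-1)%:C)).
  apply: cmeasurableM; first exact: cmeasurable_conj.
  apply: cmeasurable_real; apply: measurable_inv_real => [|x].
    exact: measurable_normsq.
  exact: normsq_ge0.
by apply/funext => x; exact: invc_normsq.
Qed.

Lemma normsqV (z : R[i]) : normsq z^-1 = (normsq z)^-1.
Proof.
have [->|z0] := eqVneq z 0; first by rewrite invr0 /normsq/= expr0n/= addr0 invr0.
have n0 : normsq z != 0 by apply: contra z0 => /eqP/normsq_eq0 ->.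
apply: (mulfI n0); rewrite -normsqM !divff//.
by rewrite /normsq/= expr0n/= addr0 expr1n.
Qed.

Lemma L2_indic (B : set X) : measurable B -> (mu B < +oo)%E ->
  exists f : L2 mu, \forall x \ae mu, f x = (\1_B x)%:C.
Proof.
move=> mB Bfin.
suff LB : (fun x => (\1_B x : R)%:C) \in L2pred mu.
  by exists (L2cls (MkL2fun LB)); exact: L2_reprP.
apply/L2predP; split; first by apply: cmeasurable_real; exact: measurable_indic.
under eq_integral => x _.
  have -> : normsq (\1_B x : R)%:C = \1_B x.
    by rewrite /normsq/= indicE; case: (x \in B) => /=; ring.
  over.
by rewrite integral_indic// setIT.
Qed.

End classes.


(** * Weighted composition operators *)
Section nonsingular_composition.
Context d (X : measurableType d) (R : realType) (mu : {measure set X -> \bar R}).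
Implicit Types (phi : X -> X) (v : X -> R[i]) (f g u : L2 mu).

(** What makes composition with phi compatible with equality almost
    everywhere. *)
Definition nonsingular phi := forall N, measurable N -> mu N = 0%E ->
  mu (phi @^-1` N) = 0%E.

Lemma nonsingular_id : nonsingular id.
Proof. by []. Qed.

Variables (phi : X -> X) (mphi : measurable_fun setT phi) (ns : nonsingular phi).

Lemma ae_comp (P : X -> Prop) :
  (\forall x \ae mu, P x) -> \forall x \ae mu, P (phi x).
Proof.
move=> [N [mN N0 PN]]; exists (phi @^-1` N); split.
- by rewrite -[X in measurable X]setTI; exact: mphi.
- exact: ns.
- by move=> x; exact: PN.
Qed.

Variables (v : X -> R[i]) (mv : cmeasurable v).

Lemma cmeasurable_wcomp g : cmeasurable (fun x => v x * g (phi x)).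
Proof.
apply: cmeasurableM => //.
exact: (cmeasurable_comp mphi (cmeasurable_L2 g)).
Qed.

Lemma wcompP g u :
  wcomp mu phi v g = Some u <-> \forall x \ae mu, u x = v x * g (phi x).
Proof. exact: (L2classP _ (cmeasurable_wcomp g)). Qed.

Lemma linear_wcomp : linear_op (wcomp mu phi v).
Proof.
split.
  apply/wcompP; have := ae_comp (L2_zeroE mu); have := L2_zeroE mu.
  by apply: filterS2 => x -> ->; rewrite mulr0.
move=> a f g u u' /wcompP fu /wcompP gu; apply/wcompP.
have A1 := L2_addE (a *: u) u'; have A2 := L2_scaleE a u.
have B1 := ae_comp (L2_addE (a *: f) g); have B2 := ae_comp (L2_scaleE a f).
have A : \forall x \ae mu, (a *: u + u' : L2 mu) x = a * (u : L2 mu) x + (u' : L2 mu) x.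
  by apply: filterS2 A1 A2 => x -> ->.
have B : \forall x \ae mu, (a *: f + g : L2 mu) (phi x) =
    a * (f : L2 mu) (phi x) + (g : L2 mu) (phi x).
  by apply: filterS2 B1 B2 => x -> ->.
apply: filterS2 (filterI A B) (filterI fu gu) => x [-> ->] [-> ->].
by rewrite mulrDr mulrCA.
Qed.

(** A fast sequence converges almost everywhere, also after composition with
    phi, so the relation v (g o phi) = 0 passes to the limit. *)
Lemma closed_ker_wcomp : closure (ker (wcomp mu phi v)) `<=` ker (wcomp mu phi v).
Proof.
move=> g /closure_fast_seq[s /all_and2[ks sg]]; apply/wcompP.
have A := ae_comp (ae_fast_bound sg).
have B : \forall x \ae mu, forall n, v x * s n (phi x) = 0.
  apply: ae_foralln => n; have /wcompP := ks n; have := L2_zeroE mu.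
  by apply: filterS2 => x -> ->.
have C : \forall x \ae mu, forall n,
    (s n - g : L2 mu) (phi x) = s n (phi x) - (g : L2 mu) (phi x).
  by apply: ae_foralln => n; apply: (ae_comp (L2_subE (s n) g)).
apply: filterS2 (filterI A B) (filterI C (L2_zeroE mu)) => x [[K gK] s0] [sE ->].
apply/esym/normsq_eq0/eqP; rewrite eq_le normsq_ge0 andbT.
apply: (@le0_geometric _ 4^-1 _ (normsq (v x) * K)) => [|n]; first by lra.
have -> : v x * (g : L2 mu) (phi x) = - (v x * (s n - g : L2 mu) (phi x)).
  by rewrite sE mulrBr s0 sub0r opprK.
rewrite -mulN1r !normsqM -mulrA (_ : normsq (-1) = 1); last first.
  by rewrite /normsq/=; ring.
by rewrite mul1r ler_wpM2l ?normsq_ge0.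
Qed.

End nonsingular_composition.

(** * The reciprocal of a product, for a weight bounded below *)
Section bounded_below_weight.
Context d (X : measurableType d) (R : realType) (mu : {measure set X -> \bar R}).
Variables (phi : X -> X) (w : X -> R[i]) (alpha : R).
Hypotheses (mphi : measurable_fun setT phi) (ns : nonsingular mu phi).
Hypotheses (mw : cmeasurable w) (alpha_gt0 : 0 < alpha).
Hypothesis w_ge : \forall x \ae mu, alpha ^+ 2 <= normsq (w x).
Implicit Types (f g h u c : L2 mu).

Let T := wcomp mu phi w.
Let C := comp_op mu phi.
Let M := mul_op mu w.

Let alpha2_gt0 : 0 < alpha ^+ 2. Proof. exact: exprn_gt0. Qed.

Let w_neq0 : \forall x \ae mu, w x != 0.
Proof.
by apply: filterS w_ge => x /(lt_le_trans alpha2_gt0); rewrite normsq_gt0.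
Qed.

Let mone : cmeasurable (cst 1 : X -> R[i]).
Proof. exact: cmeasurable_cst. Qed.

Lemma comp_opP g u : C g = Some u <-> \forall x \ae mu, u x = g (phi x).
Proof.
rewrite -[C g]/(wcomp mu phi (cst 1) g); split.
  by move/(wcompP mphi mone); apply: filterS => x ->; rewrite mul1r.
by move=> ug; apply/(wcompP mphi mone); apply: filterS ug => x ->; rewrite mul1r.
Qed.

(** The multiplication operator is the weighted composition operator of the
    identity map, whose general properties therefore apply to it. *)
Lemma mul_opP g u : M g = Some u <-> \forall x \ae mu, u x = w x * g x.
Proof.
exact: (wcompP (@measurable_id _ X setT) mw).
Qed.

Let linC : linear_op C. Proof. exact: (linear_wcomp mphi ns mone). Qed.
Let linT : linear_op T. Proof. exact: (linear_wcomp mphi ns mw). Qed.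
Let linM : linear_op M.
Proof. exact: (linear_wcomp (@measurable_id _ _ _) (@nonsingular_id _ _ _ mu) mw). Qed.
Let closedC : closure (ker C) `<=` ker C.
Proof. exact: (closed_ker_wcomp mphi ns mone). Qed.
Let closedT : closure (ker T) `<=` ker T.
Proof. exact: (closed_ker_wcomp mphi ns mw). Qed.
Let closedM : closure (ker M) `<=` ker M.
Proof. exact: (closed_ker_wcomp (@measurable_id _ _ _) (@nonsingular_id _ _ _ mu) mw). Qed.

Lemma mul_op_nsq g u : M g = Some u -> nsq g <= (alpha ^+ 2)^-1 * nsq u.
Proof.
move=> /mul_opP gu; apply: nsq_le_ae; last by rewrite invr_ge0 ltW.
apply: filterS2 gu w_ge => x -> wx.
by rewrite normsqM mulrA ler_peMl ?normsq_ge0// mulrC ler_pdivlMr ?mul1r.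
Qed.

Lemma mul_op_inj g : M g = Some 0 -> g = 0.
Proof.
move=> /mul_op_nsq; rewrite [nsq 0]/nsq linear0l mulr0 => g0.
by apply: nsq_eq0; apply/eqP; rewrite eq_le g0 nsq_ge0.
Qed.

(** By the lower bound on |w|, |k|^2 is at most alpha^-2 |f|^2. *)
Lemma L2_quotient (k : X -> R[i]) f : cmeasurable k ->
  (\forall x \ae mu, f x = w x * k x) ->
  exists2 u, M u = Some f & \forall x \ae mu, u x = k x.
Proof.
move=> mk fk; have [|u uk] := @L2_dominated _ _ _ mu k (alpha ^+ 2)^-1 f mk.
  apply: filterS2 fk w_ge => x -> wx.
  by rewrite normsqM mulrA ler_peMl ?normsq_ge0// mulrC ler_pdivlMr ?mul1r.
by exists u => //; apply/mul_opP; apply: filterS2 fk uk => x -> ->.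
Qed.

Lemma mul_op_surj f : exists u, M u = Some f.
Proof.
have [||u Mu _] := @L2_quotient (fun x => f x * (w x)^-1) f.
- by apply: cmeasurableM; [exact: cmeasurable_L2|exact: cmeasurable_inv].
- by apply: filterS w_neq0 => x wx; rewrite mulrC divfK.
- by exists u.
Qed.

(** The domains agree because g o phi is square integrable as soon as
    w (g o phi) is. *)
Lemma wcomp_mul_comp : T = op_comp M C.
Proof.
apply: poperator_ext => g f; rewrite /op_comp; split.
  move=> /(wcompP mphi mw) fg.
  have [||u Mu ug] := @L2_quotient (fun x => g (phi x)) f.
  - exact: (cmeasurable_comp mphi (cmeasurable_L2 g)).
  - exact: fg.
  - by have -> : C g = Some u by apply/comp_opP.
case Cg : (C g) => [c|//] /= /mul_opP cf.
apply/(wcompP mphi mw); move/comp_opP : Cg.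
by apply: filterS2 cf => x -> ->.
Qed.

Let T_Some g f : T g = Some f <-> exists2 c, C g = Some c & M c = Some f.
Proof.
rewrite wcomp_mul_comp /op_comp; case: (C g) => [c|]/=; last by split => // -[].
by split=> [Mc|[_ [<-]]//]; exists c.
Qed.

Lemma ker_wcomp : ker T = ker C.
Proof.
apply/seteqP; split => g; rewrite /ker/= T_Some.
  by move=> [c Cg /mul_op_inj c0]; rewrite Cg c0.
by move=> Cg; exists 0 => //; case: linM.
Qed.

Lemma reciprocal_mul_opP f u :
  reciprocal (L2dot mu) M f = Some u <-> M u = Some f.
Proof.
split=> [/(reciprocalP linM closedM)[u' [h [Mu _ rh ->]]]|Mu].
  have [z Mz] := mul_op_surj h.
  suff -> : h = 0 by rewrite addr0.
  by apply: (orthc_self (M := ran M)) => //; exists z.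
apply/(reciprocalP linM closedM); exists f, 0; split => //.
- move=> n /mul_op_inj ->; suff : L2dot mu u 0 = 0 by [].
  by apply: L2dot_eq0C; exact: (linear0l (L2dot mu)).
- exact: orthc0.
- by rewrite addr0.
Qed.

(** The criterion (P).  From right to left, the point is that an f in the
    domain of the right-hand side is in the domain of the left-hand one: the
    projection p of f onto the closure of ran T satisfies p / w = c, where c is
    the component of f / w in ran C, because both are projections of f / w onto
    the closure of ran C. *)
Lemma reciprocal_mul_comp_iff :
  reciprocal (L2dot mu) (op_comp M C) =
    op_comp (reciprocal (L2dot mu) C) (reciprocal (L2dot mu) M) <->
  forall h u, orthc (L2dot mu) (ran T) h -> M u = Some h ->
    orthc (L2dot mu) (ran C) u.
Proof.
rewrite -wcomp_mul_comp; split=> [eqT h u Th Mu|PT].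
  have : reciprocal (L2dot mu) T h = Some 0.
    apply/(reciprocalP linT closedT); exists 0, h.
    by split; [case: linT|exact: orthc0|exact: Th|rewrite add0r].
  rewrite eqT /op_comp.
  have /reciprocal_mul_opP -> /= := Mu.
  move=> /(reciprocalP linC closedC)[u' [h' [C0 _ Ch' ->]]].
  by case: linC => C00 _; move: C0; rewrite C00 => -[<-]; rewrite add0r.
apply: poperator_ext => f k; split.
  move=> /(reciprocalP linT closedT)[u [h [/T_Some[c Ck Mc] kk Th ->]]].
  have [z Mz] := mul_op_surj h.
  have Mcz : M (c + z) = Some (u + h).
    by case: linM => _ /(_ 1 _ _ _ _ Mc Mz); rewrite !scale1r.
  rewrite /op_comp; have /reciprocal_mul_opP -> /= := Mcz.
  apply/(reciprocalP linC closedC); exists c, z; split => //.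
    by rewrite -ker_wcomp.
  exact: PT Th Mz.
rewrite /op_comp; case Mf : (reciprocal _ M f) => [u|//] /=.
move/reciprocal_mul_opP : Mf => Mu.
move=> /(reciprocalP linC closedC)[c [h' [Ck kk Ch' uE]]].
have [p [q [Tp Tq fE]]] := L2_projection f (linear_set_ran linT).
have [a Ma] := mul_op_surj p; have [b Mb] := mul_op_surj q.
have Cb := PT _ _ Tq Mb.
have Mab : M (a + b) = Some f.
  by rewrite fE; case: linM => _ /(_ 1 _ _ _ _ Ma Mb); rewrite !scale1r.
have uab : u = a + b.
  apply/eqP; rewrite -subr_eq0; apply/eqP; apply: mul_op_inj.
  by rewrite -(subrr f); exact: (linear_op_sub linM).
have ac : a - c = h' - b.
  by apply/eqP; rewrite subr_eq addrAC eq_sym subr_eq -uab uE addrC.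
have a_c : a - c = 0.
  apply: (orthc_self (M := closure (ran C))); last first.
    by rewrite ac; apply: orthc_closure; exact: orthcB.
  apply/closure_nsqP => e e0; move/closure_nsqP : Tp => Tp.
  have [v [g /T_Some[c' Cg Mc'] vp]] := Tp (alpha ^+ 2 * e) (mulr_gt0 alpha2_gt0 e0).
  exists (c' - c).
    by exists (g - k); exact: (linear_op_sub linC).
  rewrite opprB addrA subrK.
  have := mul_op_nsq (linear_op_sub linM Mc' Ma).
  move=> /le_lt_trans; apply.
  by rewrite mulrC ltr_pdivrMr// mulrC.
apply/(reciprocalP linT closedT); exists p, q; split => //.
- apply/T_Some; exists c => //; rewrite -Ma; congr M.
  by apply/eqP; rewrite eq_sym -subr_eq0 a_c.
- by rewrite ker_wcomp.
Qed.

End bounded_below_weight.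


(** * Orthogonality and factorization of the weight through the map *)
Section weight_factorization.
Context d (X : measurableType d) (R : realType) (mu : {measure set X -> \bar R}).
Variables (phi : X -> X) (w : X -> R[i]) (alpha : R).
Hypotheses (mphi : measurable_fun setT phi) (ns : nonsingular mu phi).
Hypotheses (mw : cmeasurable w) (alpha_gt0 : 0 < alpha).
Hypothesis w_ge : \forall x \ae mu, alpha ^+ 2 <= normsq (w x).
Implicit Types (f g h u c : L2 mu).

Let T := wcomp mu phi w.
Let C := comp_op mu phi.
Let M := mul_op mu w.

Let alpha2_gt0 : 0 < alpha ^+ 2. Proof. exact: exprn_gt0. Qed.

(** If |w|^2 = a o phi, then for c = g o phi in ran C one has
    <h / w, c> = <h, t> with t = w ((g / a) o phi) in ran T.  For g / a to be
    square integrable, a is replaced by max a alpha^2, which equals a at phi x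
    for almost all x. *)
Lemma orthc_quotient_of_factor (a : X -> R) : measurable_fun setT a ->
  (\forall x \ae mu, normsq (w x) = a (phi x)) ->
  forall h u, orthc (L2dot mu) (ran T) h -> M u = Some h ->
    orthc (L2dot mu) (ran C) u.
Proof.
move=> ma wa h u Th /(mul_opP mw) hu.
suff uC (g c : L2 mu) : C g = Some c -> L2dot mu u c = 0.
  by move=> c [g Cg]; exact: uC Cg.
move=> /(comp_opP mphi) cg.
pose b y := (Num.max (a y) (alpha ^+ 2))^-1.
have m0 y : 0 < Num.max (a y) (alpha ^+ 2) by rewrite lt_max alpha2_gt0 orbT.
have mb : measurable_fun setT b.
  apply: measurable_inv_real => [|y]; last exact: ltW.
  by apply: measurable_maxr => //; exact: measurable_cst.
have b_le y : normsq (b y)%:C <= ((alpha ^+ 2)^-1) ^+ 2.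
  rewrite /normsq/= [_ ^+ 2 in X in _ + X]expr0n/= addr0.
  rewrite ler_sqr ?nnegrE ?invr_ge0 ?(ltW (m0 y)) ?(ltW alpha2_gt0)//.
  by rewrite lef_pV2 ?posrE// le_max lexx orbT.
have mbC : cmeasurable (fun y => (b y)%:C) by exact: cmeasurable_real.
have [g' gE] : exists g' : L2 mu, \forall x \ae mu, g' x = (b x)%:C * g x.
  apply: (@L2_dominated _ _ _ mu _ (((alpha ^+ 2)^-1) ^+ 2) g).
    exact: (cmeasurableM mbC (cmeasurable_L2 g)).
  by apply: nearW => x; rewrite normsqM ler_wpM2r ?normsq_ge0.
have bw : \forall x \ae mu, b (phi x) = (normsq (w x))^-1 /\ 0 < normsq (w x).
  apply: filterS2 wa w_ge => x wx wge.
  by rewrite /b -wx (max_idPl wge); split => //; exact: lt_le_trans wge.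
have [t tE] : exists t : L2 mu, \forall x \ae mu,
    t x = w x * (b (phi x))%:C * c x.
  apply: (@L2_dominated _ _ _ mu _ (alpha ^+ 2)^-1 c).
    apply: (cmeasurableM _ (cmeasurable_L2 c)); apply: cmeasurableM => //.
    exact: (cmeasurable_comp mphi mbC).
  apply: filterS2 bw w_ge => x [-> w0] wge.
  rewrite !normsqM ler_wpM2r ?normsq_ge0//.
  rewrite [X in _ * X](_ : _ = (normsq (w x))^-1 ^+ 2); last first.
    by rewrite /normsq/= [0 ^+ 2]expr0n/= addr0.
  by rewrite expr2 mulrA divff ?gt_eqF// mul1r lef_pV2.
have Tg' : T g' = Some t.
  apply/(wcompP mphi mw); have gphi := ae_comp mphi ns gE.
  by apply: filterS3 tE gphi cg => x -> -> ->; rewrite mulrA.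
have ht : L2dot mu h t = 0 by apply: Th; exists g'.
rewrite -ht; apply: ae_eq_cintegral.
- exact: (cmeasurableM (cmeasurable_L2 u) (cmeasurable_conj (cmeasurable_L2 c))).
- exact: (cmeasurableM (cmeasurable_L2 h) (cmeasurable_conj (cmeasurable_L2 t))).
apply: filterS3 tE hu bw => x -> -> [-> w0].
rewrite !rmorphM/= !mulrA; congr (_ * _).
rewrite [w x * u x]mulrC -!mulrA -[LHS]mulr1; congr (_ * _).
have -> : ((normsq (w x))^-1)%:C^* = ((normsq (w x))^-1)%:C :> R[i].
  by apply/eqP; rewrite eq_complex/= oppr0 !eqxx.
by rewrite mulrA normsq_conj -rmorphM/= divff ?gt_eqF.
Qed.

(** Elements of the closure of ran T still are multiples by w of functions of
    phi, as an almost everywhere limit of the w (g n o phi).  Only the real part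
    is recorded, since the quotients of interest are real. *)
Lemma closure_ran_quotient f : closure (ran T) f ->
  exists2 k : X -> R, measurable_fun setT k &
    \forall x \ae mu, k (phi x) = complex.Re (f x / w x).
Proof.
move=> /closure_fast_seq[s /all_and2[Ts sf]].
have [g_ Tg] : exists g_ : nat -> L2 mu, forall n, T (g_ n) = Some (s n).
  by have [g_ Tg] := choice Ts; exists g_.
exists (limsup_fun (fun n y => complex.Re (g_ n y))).
  by apply: measurable_limsup_fun => n; case: (cmeasurable_L2 (g_ n)).
have sE : \forall x \ae mu, forall n, s n x = w x * g_ n (phi x).
  by apply: ae_foralln => n; apply/(wcompP mphi mw).
have dE : \forall x \ae mu, forall n, (s n - f : L2 mu) x = s n x - f x.
  by apply: ae_foralln => n; exact: L2_subE.
apply: filterS3 (ae_fast_bound sf) (filterI sE dE) w_ge => x [K bnd] [sx dx] wx.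
have w0 : 0 < normsq (w x) by exact: lt_le_trans wx.
have wn0 : w x != 0 by rewrite -normsq_gt0.
apply: limsup_fun_cvg.
pose z n := g_ n (phi x) - f x / w x.
have zE n : z n = (s n - f : L2 mu) x / w x.
  by rewrite dx sx mulrBl mulrAC divff// mul1r.
have zbnd n : (complex.Re (z n)) ^+ 2 <= K / normsq (w x) * 4^-1 ^+ n.
  apply: (@le_trans _ _ (normsq (z n))); first by rewrite /normsq lerDl sqr_ge0.
  by rewrite zE normsqM normsqV mulrAC ler_wpM2r// invr_ge0 ltW.
have -> : (fun n => complex.Re (g_ n (phi x))) =
          (fun n => complex.Re (z n) + complex.Re (f x / w x)).
  apply/funext => n; rewrite /z; case: (g_ n (phi x)) => p q /=.
  by case: (f x / w x) => p' q' /=; rewrite subrK.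
rewrite -[X in _ --> X]add0r; apply: cvgD; last exact: cvg_cst.
exact: cvg0_fast zbnd.
Qed.

Hypothesis orthP : forall h u, orthc (L2dot mu) (ran T) h -> M u = Some h ->
  orthc (L2dot mu) (ran C) u.

(** Take g the indicator of D and e = (g o phi) / conj w.  By orthP, e is
    orthogonal to the orthogonal complement of ran T, hence in the closure of
    ran T, so e / w = (1_D o phi) / |w|^2 is a function of phi. *)
Lemma factor_on (D : set X) : measurable D -> (mu D < +oo)%E ->
  (mu (phi @^-1` D) < +oo)%E ->
  exists a : X -> R, [/\ measurable_fun setT a &
    \forall x \ae mu, a (phi x) = \1_D (phi x) * normsq (w x)].
Proof.
move=> mD Dfin pDfin.
have mpD : measurable (phi @^-1` D) by rewrite -[X in measurable X]setTI; exact: mphi.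
have indE x : \1_(phi @^-1` D) x = \1_D (phi x) :> R.
  by rewrite !indicE; congr (_%:R); apply/idP/idP; rewrite !inE.
have [g gE] := L2_indic mD Dfin; have [c cE] := L2_indic mpD pDfin.
have Cg : C g = Some c.
  apply/(comp_opP mphi); have gphi := ae_comp mphi ns gE.
  by apply: filterS2 cE gphi => x -> ->; rewrite indE.
have w_gt : \forall x \ae mu, 0 < normsq (w x).
  by apply: filterS w_ge => x; exact: lt_le_trans.
have mwc : cmeasurable (fun x => ((w x)^*)^-1).
  by apply: cmeasurable_inv; exact: cmeasurable_conj.
have normsqC (z : R[i]) : normsq z^* = normsq z.
  by case: z => p q; rewrite /normsq/= sqrrN.
have [e eE] : exists e : L2 mu, \forall x \ae mu, e x = c x * ((w x)^*)^-1.
  apply: (@L2_dominated _ _ _ mu _ (alpha ^+ 2)^-1 c).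
    exact: (cmeasurableM (cmeasurable_L2 c) mwc).
  apply: filterS w_ge => x wge.
  rewrite normsqM mulrC normsqV normsqC ler_wpM2r ?normsq_ge0// lef_pV2 ?posrE//.
  exact: lt_le_trans wge.
have orth_e : orthc (L2dot mu) (orthc (L2dot mu) (ran T)) e.
  move=> h Th; suff : L2dot mu e h = 0 by [].
  apply: L2dot_eq0C; have [u Mu] := mul_op_surj mw alpha_gt0 w_ge h.
  have uc : L2dot mu u c = 0 by apply: (orthP Th Mu); exists g.
  rewrite -uc; apply: ae_eq_cintegral.
  - exact: (cmeasurableM (cmeasurable_L2 h) (cmeasurable_conj (cmeasurable_L2 e))).
  - exact: (cmeasurableM (cmeasurable_L2 u) (cmeasurable_conj (cmeasurable_L2 c))).
  move/(mul_opP mw) : Mu => hu.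
  apply: filterS3 eE hu w_gt => x -> -> w0.
  have wn0 : w x != 0 by rewrite -normsq_gt0.
  rewrite rmorphM/= fmorphV/= conjCK -mulrA mulrCA; congr (_ * _).
  by rewrite mulrCA divff// mulr1.
have linT : linear_op T by exact: (linear_wcomp mphi ns mw).
have [k mk ke] :=
  closure_ran_quotient (orthc_orthc_closure (linear_set_ran linT) orth_e).
have kE : \forall x \ae mu, k (phi x) = \1_D (phi x) / normsq (w x).
  apply: filterS3 ke eE cE => x -> -> ->; rewrite indE -mulrA -invfM.
  by rewrite [(w x)^* * _]mulrC normsq_conj -fmorphV -rmorphM.
have mkV : measurable_fun setT (fun y => (Num.max (k y) 0)^-1).
  apply: measurable_inv_real; last by move=> y; rewrite le_max lexx orbT.
  by apply: measurable_maxr => //; exact: measurable_cst.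
(* k is positive at almost all points phi x of D, where the truncation at 0
   is the identity; elsewhere it only serves measurability *)
exists (fun y => \1_D y * (Num.max (k y) 0)^-1); split.
  by apply: measurable_funM => //; exact: measurable_indic.
apply: filterS2 kE w_gt => x -> w0.
rewrite indicE; case: (_ \in D) => /=; rewrite ?mul0r// !mul1r.
by rewrite (max_idPl _) ?invrK// invr_ge0 ltW.
Qed.

(** The supremum of the local factors: at a given point the n-th one is |w|^2
    or 0, and the sets F n cover X. *)
Lemma factor_of_orthc_quotient (F : (set X)^nat) : \bigcup_n F n = setT ->
  (forall n, measurable (F n)) -> (forall n, mu (F n) < +oo)%E ->
  (forall n, mu (phi @^-1` F n) < +oo)%E ->
  exists a : X -> R, [/\ measurable_fun setT a, forall y, 0 <= a y &
    \forall x \ae mu, normsq (w x) = a (phi x)].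
Proof.
move=> TF mF Ffin pFfin.
have [a_ /all_and2[ma aE]] := choice (fun n => factor_on (mF n) (Ffin n) (pFfin n)).
pose e y := esups (fun n => (Num.max (a_ n y) 0)%:E) 0%N.
have me : measurable_fun setT e.
  apply: (@measurable_fun_esups _ _ _ _ (fun n y => (Num.max (a_ n y) 0)%:E)) => n.
  by apply/measurable_EFinP; apply: measurable_maxr => //; exact: measurable_cst.
have e_ub n y : ((Num.max (a_ n y) 0)%:E <= e y)%E by apply: ereal_sup_ubound; exists n.
exists (fine \o e); split.
- by apply: measurableT_comp me; exact: fine_measurable.
- move=> y /=; apply: fine_ge0; apply: le_trans (e_ub 0%N y).
  by rewrite lee_fin le_max lexx orbT.
have := ae_foralln aE; apply: filterS => x aEx.
have [n _ Fn] : (\bigcup_n F n) (phi x) by rewrite TF.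
rewrite /=; suff -> : e (phi x) = (normsq (w x))%:E by [].
apply/eqP; rewrite eq_le; apply/andP; split.
  apply: ge_ereal_sup => _ [m _ <-]; rewrite aEx lee_fin ge_max normsq_ge0 andbT.
  by rewrite indicE; case: (_ \in _); rewrite ?mul1r ?mul0r ?normsq_ge0.
apply: le_trans (e_ub n _); rewrite aEx indicE mem_set// mul1r.
by rewrite lee_fin le_max lexx.
Qed.

End weight_factorization.


(** * The weighted pushforward measure *)
Section weighted_pushforward.
Context d (X : measurableType d) (R : realType) (mu : {measure set X -> \bar R}).
Local Open Scope ereal_scope.

Section measure_instance.
Variables (phi : X -> X) (v : X -> R[i]).
Hypotheses (mphi : measurable_fun setT phi) (mv : cmeasurable v).

Lemma measurable_preimage D : measurable D -> measurable (phi @^-1` D).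
Proof. by move=> mD; rewrite -[X in measurable X]setTI; exact: mphi. Qed.

Lemma measurable_weight : measurable_fun setT (fun x => (normsq (v x))%:E).
Proof. exact/measurable_EFinP/measurable_normsq. Qed.

(** The set function wpushforward, carrying the measurability proofs that make
    it a measure. *)
Definition wpush (_ : measurable_fun setT phi) (_ : cmeasurable v) :=
  wpushforward mu phi v.
Local Notation nu := (wpush mphi mv).

Let wpush0 : nu set0 = 0.
Proof. by rewrite /wpush /wpushforward preimage_set0 integral_set0. Qed.

Let wpush_ge0 D : 0 <= nu D.
Proof. by apply: integral_ge0 => x _; rewrite lee_fin normsq_ge0. Qed.

Let wpush_sigma_additive : semi_sigma_additive nu.
Proof.
move=> F mF tF mUF; rewrite /wpush /wpushforward preimage_bigcup.
apply: (semi_sigma_additive_nng_induced measurable_weight).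
- by move=> x; rewrite lee_fin normsq_ge0.
- by move=> n; exact: measurable_preimage.
- apply/trivIsetP => i j _ _ ij; rewrite -preimage_setI.
  by move/trivIsetP : tF => ->//; rewrite preimage_set0.
- by rewrite -preimage_bigcup; exact: measurable_preimage.
Qed.

HB.instance Definition _ := isMeasure.Build _ _ _ nu
  wpush0 wpush_ge0 wpush_sigma_additive.

End measure_instance.

Variables (phi : X -> X) (mphi : measurable_fun setT phi).

Lemma wpush_one D : measurable D -> wpushforward mu phi (cst 1%R) D = mu (phi @^-1` D).
Proof.
move=> mD; rewrite /wpushforward (eq_integral (cst 1)); last first.
  by move=> x _; congr EFin; rewrite /normsq/=; ring.
by rewrite integral_cst ?mul1e//; exact: measurable_preimage.
Qed.

(** Change of variables: the weighted pushforward is the pushforward of the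
    measure with density |v|^2. *)
Lemma integral_wpush v (mv : cmeasurable v) (g : X -> \bar R) D :
  (forall x, 0 <= g x) -> measurable D -> measurable_fun setT g ->
  \int[wpush mphi mv]_(x in D) g x =
  \int[mu]_(x in phi @^-1` D) (g (phi x) * (normsq (v x))%:E).
Proof.
move=> g0 mD mg; pose kappa := wpush (@measurable_id _ _ _) mv.
transitivity (\int[kappa]_(x in phi @^-1` D) (g \o phi) x).
  rewrite -(ge0_integral_pushforward mphi kappa mD)//.
  exact: measurable_funTS.
apply: integral_density => //.
- exact: measurable_normsq.
- by move=> x; exact: normsq_ge0.
- by move=> x; exact: g0.
- exact: measurable_preimage.
- by apply: measurable_funTS; exact: measurableT_comp.
Qed.

(** As w does not vanish, mu and the measure with density |w|^2 have the same
    null sets. *)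
Lemma well_defined_nonsingular w : cmeasurable w ->
  (\forall x \ae mu, w x != 0%R) -> well_defined mu phi w -> nonsingular mu phi.
Proof.
move=> mw w0 /null_content_dominatesP wd N mN N0.
have mpN := measurable_preimage mphi mN.
have : \int[mu]_(x in phi @^-1` N) `|(normsq (w x))%:E| = 0.
  rewrite -[RHS](wd _ mN N0); apply: eq_integral => x _.
  by rewrite gee0_abs// lee_fin normsq_ge0.
move/(ae_eq_integral_abs mu mpN (measurable_funTS (measurable_weight mw))) => wN.
apply: (measure_negligible mpN).
have : \forall x \ae mu, ~ (phi @^-1` N) x.
  apply: filterS2 wN w0 => x wNx wx Nx; move: wx; apply/negP/negPn/eqP.
  by have [] := wNx Nx; exact: normsq_eq0.
by apply: negligibleS => x Nx; exact.
Qed.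

Lemma nonsingular_well_defined w : cmeasurable w ->
  nonsingular mu phi -> well_defined mu phi w.
Proof.
move=> mw ns; apply/null_content_dominatesP => N mN N0.
have mpN := measurable_preimage mphi mN.
by apply: null_set_integral => //; [exact/measurable_funTS/measurable_weight|exact: ns].
Qed.

(** If g is in the domain of C_{phi,v}, the sets {1 / (m + 1) <= |g|^2} have
    finite measure and finite weighted pushforward, by Markov's inequality
    applied to g and to its image.  Approximating the indicators of a cover by
    sets S n of finite measure, such sets exhaust X up to the set N where all
    the approximants vanish; N is null, since the indicator of S n is at squared
    distance at least mu (N `&` S n) from any function vanishing on N. *)
Lemma densely_defined_cover v : cmeasurable v -> sigma_finite setT mu ->
  well_defined mu phi v -> dense (dom (wcomp mu phi v)) ->
  exists F : (set X)^nat, [/\ \bigcup_n F n = setT, forall n, measurable (F n),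
    forall n, mu (F n) < +oo & forall n, wpushforward mu phi v (F n) < +oo].
Proof.
move=> mv [S TS mS] /null_content_dominatesP wd /dense_closureP dd.
have near (i : nat * nat) : exists gu : L2 mu * L2 mu,
    wcomp mu phi v gu.1 = Some gu.2 /\
    \int[mu]_(x in S i.1) (normsq (gu.1 x - 1))%:E < (i.2.+1%:R^-1)%:E.
  have [f fE] := L2_indic (mS i.1).1 (mS i.1).2.
  have /closure_nsqP/(_ i.2.+1%:R^-1%R) := dd f.
  have i0 : (0 < i.2.+1%:R^-1 :> R)%R by rewrite invr_gt0.
  move=> /(_ i0) [g +]; rewrite /dom/=; case gu : (wcomp mu phi v g) => [u|//] _ gf.
  exists (g, u); split => //=; apply: (@le_lt_trans _ _ (nsq (g - f))%:E) => //.
  rewrite nsq_integral.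
  apply: (@le_trans _ _ (\int[mu]_(x in S i.1) (normsq ((g - f : L2 mu) x))%:E)).
    apply: ae_ge0_le_integral => //.
    - exact: (mS i.1).1.
    - by move=> x _; rewrite lee_fin normsq_ge0.
    - apply/measurable_funTS/measurable_EFinP/measurable_normsq.
      apply: cmeasurableB; [exact: cmeasurable_L2|exact: cmeasurable_cst].
    - by move=> x _; rewrite lee_fin normsq_ge0.
    - exact/measurable_funTS/measurable_L2_normsq.
    - apply: filterS2 (L2_subE g f) fE => x -> -> Sx.
      by rewrite indicE mem_set.
  apply: ge0_subset_integral => //; first exact: (mS i.1).1.
    exact: measurable_L2_normsq.
  by move=> x _; rewrite lee_fin normsq_ge0.
have [gu /all_and2[guE gu1]] := choice near.
pose G (j : nat * nat * nat) :=
  [set x | ((j.2.+1%:R^-1 : R)%:E <= (normsq ((gu j.1).1 x))%:E)].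
have mG j : measurable (G j).
  rewrite -[X in measurable X]setTI; apply: emeasurable_fun_c_infty => //.
  exact: measurable_L2_normsq.
pose N := ~` \bigcup_j G j.
have mUG : measurable (\bigcup_j G j).
  by apply: countable_bigcupT_measurable.
have mN : measurable N by exact: measurableC.
have gN i x : N x -> (gu i).1 x = 0%R.
  move=> Nx; apply: normsq_eq0; apply/eqP; rewrite eq_le normsq_ge0 andbT leNgt.
  apply/negP => g0; apply: Nx.
  exists (i, Num.trunc (normsq ((gu i).1 x))^-1) => //=.
  rewrite /G/= lee_fin -[leRHS]invrK lef_pV2 ?posrE ?invr_gt0//.
  exact/ltW/truncnS_gt.
have muNS n : mu (N `&` S n) = 0.
  have mNS : measurable (N `&` S n) by apply: measurableI => //; exact: (mS n).1.
  apply/eqP; rewrite -measure_le0; apply/lee_addgt0Pr => e e0; rewrite add0e.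
  apply: (@le_trans _ _ ((Num.trunc e^-1).+1%:R^-1)%:E); last first.
    rewrite lee_fin -[leRHS]invrK lef_pV2 ?posrE ?invr_gt0//.
    exact/ltW/truncnS_gt.
  apply: le_trans (ltW (gu1 (n, Num.trunc e^-1))).
  apply: (@le_trans _ _ (\int[mu]_(x in N `&` S n)
      (normsq ((gu (n, Num.trunc e^-1)).1 x - 1))%:E)).
    under eq_integral => x /[!inE] -[Nx _].
      rewrite (gN _ _ Nx) (_ : normsq _ = 1%R); last by rewrite /normsq/=; ring.
      over.
    by rewrite integral_cst// mul1e.
  apply: ge0_subset_integral => //; first exact: (mS n).1.
    apply/measurable_funTS/measurable_EFinP/measurable_normsq.
    by apply: cmeasurableB; [exact: cmeasurable_L2|exact: cmeasurable_cst].
  by move=> x _; rewrite lee_fin normsq_ge0.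
have muN : mu N = 0.
  apply: (measure_negligible mN).
  have : mu.-negligible (\bigcup_n (N `&` S n)).
    apply: negligible_bigcup => n; exists (N `&` S n); split => //.
    by apply: measurableI => //; exact: (mS n).1.
  by apply: negligibleS => x Nx; rewrite -setI_bigcupr -TS setIT.
(* N comes first, then the G j in the order of their codes *)
pose F n := if n is m.+1 then
  (if unpickle m is Some j then G j else set0) else N.
exists F; split.
- apply/seteqP; split => // x _.
  have [[j _ Gx]|Nx] := pselect ((\bigcup_j G j) x); last by exists 0%N.
  by exists (pickle j).+1 => //=; rewrite pickleK.
- by case=> [|m] //=; case: unpickle.
- case=> [|m] /=; first by rewrite muN.
  case: unpickle => [j|]; last by rewrite measure0.
  have : \int[mu]_(x in G j) (j.2.+1%:R^-1 : R)%:E <= \int[mu]_x (normsq ((gu j.1).1 x))%:E.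
    apply: (@le_trans _ _ (\int[mu]_(x in G j) (normsq ((gu j.1).1 x))%:E)).
      apply: ge0_le_integral => //; first by exact/measurable_funTS/measurable_L2_normsq.
    apply: ge0_subset_integral => //; first exact: measurable_L2_normsq.
    by move=> x _; rewrite lee_fin normsq_ge0.
  rewrite integral_cst// -nsq_integral -lee_pdivlMl ?invr_gt0// => /le_lt_trans; apply.
  by rewrite -EFinM ltry.
- case=> [|m] /=; first by rewrite (wd _ mN muN).
  case: unpickle => [j|]; last by rewrite /wpushforward preimage_set0 integral_set0.
  have mpG := measurable_preimage mphi (mG j).
  have : \int[mu]_(x in phi @^-1` G j) (normsq (v x))%:E <=
         \int[mu]_x (j.2.+1%:R%:E * (normsq ((gu j.1).2 x))%:E).
    have mr : measurable_fun setT (fun x => j.2.+1%:R%:E * (normsq ((gu j.1).2 x))%:E).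
      by apply: measurable_funeM; exact: measurable_L2_normsq.
    apply: (@le_trans _ _ (\int[mu]_(x in phi @^-1` G j)
        (j.2.+1%:R%:E * (normsq ((gu j.1).2 x))%:E))).
      apply: ae_ge0_le_integral => //.
      - by move=> x _; rewrite lee_fin normsq_ge0.
      - exact/measurable_funTS/measurable_weight.
      - by move=> x _; rewrite -EFinM lee_fin mulr_ge0// normsq_ge0.
      - exact: measurable_funTS.
      - have /(wcompP mphi mv) := guE j.1; apply: filterS => x -> /=.
        rewrite /G/= -EFinM !lee_fin normsqM => Gx.
        by rewrite mulrCA ler_peMr ?normsq_ge0// -ler_pdivrMl ?mulr1.
    apply: ge0_subset_integral => //.
    by move=> x _; rewrite -EFinM lee_fin mulr_ge0// normsq_ge0.
  rewrite ge0_integralZl//; last 2 first.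
  - exact: measurable_L2_normsq.
  - by move=> x _; rewrite lee_fin normsq_ge0.
  by rewrite -nsq_integral -EFinM => /le_lt_trans; apply; rewrite ltry.
Qed.

End weighted_pushforward.


(** * Radon-Nikodym derivatives of the weighted pushforward *)
Section radon_nikodym.
Context d (X : measurableType d) (R : realType).
Variable mu : {sigma_finite_measure set X -> \bar R}.
Variables (phi : X -> X) (mphi : measurable_fun setT phi).
Implicit Types v : X -> R[i].
Local Open Scope ereal_scope.

(** Uniqueness holds because mu is sigma-finite. *)
Lemma RN_derivE v (h : X -> \bar R) : is_RN_deriv mu phi v h ->
  \forall x \ae mu, RN_deriv mu phi v x = h x.
Proof.
move=> hP; have [mh h0 hE] := hP.
have [mk k0 kE] : is_RN_deriv mu phi v (RN_deriv mu phi v).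
  exact: (@xgetPex _ (cst 0) [set h | is_RN_deriv mu phi v h] (ex_intro _ h hP)).
apply: ae_eq_of_integral => //; first exact: sigma_finiteT.
by move=> D mD; rewrite -kE// hE.
Qed.

Lemma RN_deriv_exists v (F : (set X)^nat) : cmeasurable v ->
  well_defined mu phi v -> \bigcup_n F n = setT ->
  (forall n, measurable (F n)) -> (forall n, wpushforward mu phi v (F n) < +oo) ->
  exists h : X -> R, [/\ measurable_fun setT h, forall x, (0 <= h x)%R &
    is_RN_deriv mu phi v (EFin \o h)].
Proof.
move=> mv wd FT mF Ffin.
have [||h [mh h0 hE]] := @sigma_finite_radon_nikodym _ _ _ mu (wpush mu mphi mv).
- by exists F => // n; split => //; exact: Ffin.
- exact: wd.
exists h; split => //; split.
- exact/measurable_EFinP.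
- by move=> x; rewrite lee_fin.
- exact: hE.
Qed.

(** By change of variables the measure of D attached to v / (h o phi) is the
    integral over D of h^(-2) h = h^(-1); at the zeros of h both sides are 0 by
    the convention 0^-1 = 0. *)
Lemma is_RN_deriv_hat v (h : X -> R) : nonsingular mu phi -> cmeasurable v ->
  measurable_fun setT h -> (forall x, (0 <= h x)%R) ->
  is_RN_deriv mu phi v (EFin \o h) ->
  is_RN_deriv mu phi (hat mu phi v) (fun x => (h x)^-1%:E).
Proof.
move=> ns mv mh h0 hP; have [_ _ hE] := hP.
have mhV : measurable_fun setT (fun x => (h x)^-1%R) by exact: measurable_inv_real.
split.
- exact/measurable_EFinP.
- by move=> x; rewrite lee_fin invr_ge0.
move=> D mD; rewrite /wpushforward.
pose g x : \bar R := ((h x)^-1 ^+ 2)%:E.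
have mg : measurable_fun setT g by apply/measurable_EFinP; exact: measurable_funX.
have g0 x : 0 <= g x by rewrite lee_fin sqr_ge0.
have mRN : measurable_fun setT (RN_deriv mu phi v).
  by have [] := @xgetPex _ (cst 0) [set h | is_RN_deriv mu phi v h] (ex_intro _ _ hP).
transitivity (\int[mu]_(x in phi @^-1` D) (g (phi x) * (normsq (v x))%:E)).
  have mpD := measurable_preimage mphi mD.
  apply: ae_eq_integral => //.
  - apply/measurable_funTS/measurable_EFinP/measurable_normsq.
    apply: cmeasurableM => //; apply: cmeasurable_inv; apply: cmeasurable_real.
    by apply: measurableT_comp; [exact: fine_measurable|exact: measurableT_comp].
  - apply: measurable_funTS; apply: emeasurable_funM; first exact: measurableT_comp.
    exact: measurable_weight.
  - have := ae_comp mphi ns (RN_derivE hP); apply: filterS => x hx _.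
    rewrite /hat hx/= /g -EFinM normsqM normsqV mulrC; congr (_ * _)%:E.
    by rewrite /normsq/= expr0n/= addr0 exprVn.
rewrite -(integral_wpush mu mphi mv)//.
rewrite [LHS](@integral_density _ _ _ mu _ h)//; last exact: measurable_funTS.
apply: eq_integral => x _; rewrite /g -EFinM; congr EFin.
have [->|hx] := eqVneq (h x) 0%R; first by rewrite mulr0 invr0.
by rewrite expr2 -mulrA mulVf// mulr1.
Qed.

(** The inequality h_w >= alpha^2 h_1 can be inverted where h_1 > 0; where
    h_1 = 0 the function h_w vanishes too, by nonsingularity. *)
Lemma RN_deriv_hat_le (w : X -> R[i]) (F : (set X)^nat) (alpha : R) :
  nonsingular mu phi -> cmeasurable w -> (0 < alpha)%R ->
  (\forall x \ae mu, (alpha ^+ 2 <= normsq (w x))%R) ->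
  \bigcup_n F n = setT -> (forall n, measurable (F n)) ->
  (forall n, wpushforward mu phi w (F n) < +oo) ->
  (forall n, wpushforward mu phi (cst 1%R) (F n) < +oo) ->
  \forall x \ae mu, RN_deriv mu phi (hat mu phi w) x <=
    (alpha ^+ 2)^-1%:E * RN_deriv mu phi (hat mu phi (cst 1%R)) x.
Proof.
move=> ns mw a0 wge FT mF Fw F1.
have mone : cmeasurable (cst 1%R : X -> R[i]) by exact: cmeasurable_cst.
have [hw [mhw hw0 hwP]] :=
  RN_deriv_exists mw (nonsingular_well_defined mphi mw ns) FT mF Fw.
have [h1 [mh1 h10 h1P]] :=
  RN_deriv_exists mone (nonsingular_well_defined mphi mone ns) FT mF F1.
have hatw := RN_derivE (is_RN_deriv_hat ns mw mhw hw0 hwP).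
have hat1 := RN_derivE (is_RN_deriv_hat ns mone mh1 h10 h1P).
have [_ _ hwE] := hwP; have [_ _ h1E] := h1P.
have a20 : (0 < alpha ^+ 2)%R by exact: exprn_gt0.
have le1w : \forall x \ae mu, (alpha ^+ 2 * h1 x <= hw x)%R.
  have : \forall x \ae mu, ((alpha ^+ 2 * h1 x)%:E <= (hw x)%:E).
    apply: ae_le_of_integral.
    - exact: sigma_finiteT.
    - by apply/measurable_EFinP; exact: measurable_funM.
    - exact/measurable_EFinP.
    - by move=> x; rewrite lee_fin mulr_ge0// ltW.
    - by move=> x; rewrite lee_fin.
    move=> D mD; under eq_integral do rewrite EFinM.
    rewrite ge0_integralZl ?lee_fin ?(ltW a20)//; last 2 first.
    - by apply/measurable_funTS/measurable_EFinP.
    - by move=> x _; rewrite lee_fin.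
    rewrite -[X in _ * X](h1E D mD) -[leRHS](hwE D mD).
    have mpD := measurable_preimage mphi mD.
    rewrite -ge0_integralZl ?lee_fin ?(ltW a20)//; last 2 first.
    - exact/measurable_funTS/measurable_weight.
    - by move=> x _; rewrite lee_fin normsq_ge0.
    apply: ae_ge0_le_integral => //.
    - by move=> x _; rewrite -EFinM lee_fin mulr_ge0 ?normsq_ge0// ltW.
    - by apply: measurable_funeM; exact/measurable_funTS/measurable_weight.
    - by move=> x _; rewrite lee_fin normsq_ge0.
    - exact/measurable_funTS/measurable_weight.
    - apply: filterS wge => x wx _; rewrite -EFinM lee_fin.
      by rewrite (_ : normsq _ = 1%R) ?mulr1//; rewrite /normsq/=; ring.
  by apply: filterS => x; rewrite lee_fin.
have zero1w : \forall x \ae mu, h1 x = 0%R -> hw x = 0%R.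
  pose Z := [set x | h1 x = 0%R].
  have mZ : measurable Z.
    rewrite (_ : Z = setT `&` h1 @^-1` [set 0%R]); last by rewrite setTI.
    by apply: mh1 => //; exact: measurable_set1.
  have mpZ := measurable_preimage mphi mZ.
  have pZ0 : mu (phi @^-1` Z) = 0.
    rewrite -(wpush_one mu mphi mZ) h1E// (eq_integral (cst 0)) ?integral0// => x.
    by rewrite inE /Z/= => ->.
  have : \int[mu]_(x in Z) `|(hw x)%:E| = 0.
    rewrite (eq_integral (EFin \o hw)); last by move=> x _; rewrite gee0_abs ?lee_fin.
    rewrite -hwE//; apply: null_set_integral => //.
    exact/measurable_funTS/measurable_weight.
  move/ae_eq_integral_abs => /(_ mZ).
  have mhwZ : measurable_fun Z (fun x => (hw x)%:E).
    exact/measurable_funTS/measurable_EFinP.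
  by move=> /(_ mhwZ); apply: filterS => x hx /hx [].
apply: filterS3 (filterI hatw hat1) le1w zero1w => x [-> ->] le1 z1.
rewrite -EFinM lee_fin -invfM.
have [h1z|h1n] := eqVneq (h1 x) 0%R; first by rewrite z1// h1z mulr0.
have h1p : (0 < h1 x)%R by rewrite lt_neqAle eq_sym h1n h10.
by rewrite lef_pV2// posrE ?(lt_le_trans _ le1)// mulr_gt0.
Qed.

End radon_nikodym.

(** * Conditional expectation and factorization *)
Section conditional_expectation.
Context d (X : measurableType d) (R : realType) (mu : {measure set X -> \bar R}).
Variables (phi : X -> X) (mphi : measurable_fun setT phi) (f : X -> \bar R).
Local Open Scope ereal_scope.

(** Whether or not a conditional expectation of f exists, cond_exp is
    measurable with respect to the preimages under phi. *)
Lemma cond_exp_factor : exists b : X -> \bar R, [/\ measurable_fun setT b,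
  forall y, 0 <= b y & forall x, cond_exp mu phi f x = b (phi x)].
Proof.
apply: preimage_measurable_factor; rewrite /cond_exp; case: xgetP => [g _ []//|_].
  exact: measurable_cst.
by [].
Qed.

(** A function of phi is its own conditional expectation; uniqueness is
    ae_eq_of_integral for the pushforward of mu, which is sigma-finite by the
    cover F. *)
Lemma cond_exp_of_factor (a : X -> \bar R) (F : (set X)^nat) :
  nonsingular mu phi ->
  measurable_fun setT a -> (forall y, 0 <= a y) -> measurable_fun setT f ->
  (forall x, 0 <= f x) -> (\forall x \ae mu, f x = a (phi x)) ->
  \bigcup_n F n = setT -> (forall n, measurable (F n)) ->
  (forall n, mu (phi @^-1` F n) < +oo) ->
  \forall x \ae mu, f x = cond_exp mu phi f x.
Proof.
move=> ns ma a0 mf f0 fa FT mF Ffin.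
have fE D : measurable D -> \int[mu]_(x in phi @^-1` D) a (phi x) =
    \int[mu]_(x in phi @^-1` D) f x.
  move=> mD; apply: ae_eq_integral.
  - exact: measurable_preimage.
  - by apply: measurable_funTS; exact: measurableT_comp.
  - exact: measurable_funTS.
  - by apply: filterS fa => x ->.
have aP : is_cond_exp mu phi f (a \o phi).
  split => //; last by move=> x; exact: a0.
  move=> _ B mB; exists (a @^-1` B); last by rewrite !setTI.
  by rewrite -[X in measurable X]setTI; exact: ma.
have [_ _ cE] : is_cond_exp mu phi f (cond_exp mu phi f).
  exact: (@xgetPex _ (cst 0) [set g | is_cond_exp mu phi f g] (ex_intro _ _ aP)).
have [b [mb b0 bE]] := cond_exp_factor.
have mone : cmeasurable (cst 1%R : X -> R[i]) by exact: cmeasurable_cst.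
have pushE g D : measurable D -> measurable_fun setT g -> (forall y, 0 <= g y) ->
    \int[wpush mu mphi mone]_(x in D) g x = \int[mu]_(x in phi @^-1` D) g (phi x).
  move=> mD mg g0; rewrite integral_wpush//; apply: eq_integral => x _.
  by rewrite (_ : normsq _ = 1%R) ?mule1//; rewrite /normsq/=; ring.
have ab : \forall y \ae wpush mu mphi mone, a y = b y.
  apply: ae_eq_of_integral => //.
    exists F => // n; split => //.
    by apply: le_lt_trans (Ffin n); rewrite -(wpush_one mu mphi (mF n)).
  move=> D mD; rewrite !pushE// fE//.
  by rewrite -cE//; apply: eq_integral => x _; rewrite bE.
have [N [mN N0 abN]] := ab.
have abphi : \forall x \ae mu, a (phi x) = b (phi x).
  exists (phi @^-1` N); split.
  - exact: measurable_preimage.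
  - by rewrite -(wpush_one mu mphi mN).
  - by move=> x; exact: abN.
by apply: filterS2 fa abphi => x -> ->; rewrite bE.
Qed.

End conditional_expectation.

Theorem proposition21 (d : measure_display) (X : measurableType d)
    (R : realType) (mu : {sigma_finite_measure set X -> \bar R})
    (phi : X -> X) (w : X -> R[i])
    (mphi : measurable_fun setT phi) (mw : cmeasurable w)
    (dd : densely_defined mu phi w)
    (alpha : R) (alpha_gt0 : 0 < alpha)
    (w_gt_alpha : \forall x \ae mu, alpha%:C < `|w x|) :
  densely_defined mu phi (cst 1%R)
  /\ wcomp mu phi w = op_comp (mul_op mu w) (comp_op mu phi)
  /\ (reciprocal (L2dot mu) (op_comp (mul_op mu w) (comp_op mu phi))
      = op_comp (reciprocal (L2dot mu) (comp_op mu phi))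
                (reciprocal (L2dot mu) (mul_op mu w))
      <->
      (exists2 beta : R, 0 < beta &
         \forall x \ae mu,
           (RN_deriv mu phi (hat mu phi w) x
            <= beta%:E * RN_deriv mu phi (hat mu phi (cst 1%R)) x)%E)
      /\ (\forall x \ae mu,
            (normsq (w x))%:E
            = cond_exp mu phi (fun y => (normsq (w y))%:E) x)).
Proof.
have a20 : 0 < alpha ^+ 2 by exact: exprn_gt0.
have mone : cmeasurable (cst 1 : X -> R[i]) by exact: cmeasurable_cst.
have w_ge : \forall x \ae mu, alpha ^+ 2 <= normsq (w x).
  apply: filterS w_gt_alpha => x /ltW aw; rewrite -lecR normsqE rmorphXn/=.
  by rewrite ler_sqr ?nnegrE// lecR ltW.
have w_neq0 : \forall x \ae mu, w x != 0.
  by apply: filterS w_ge => x /(lt_le_trans a20); rewrite normsq_gt0.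
have ns := well_defined_nonsingular mphi mw w_neq0 dd.1.
have wE := wcomp_mul_comp mphi mw alpha_gt0 w_ge.
have [F [FT mF Fmu Fw]] :=
  densely_defined_cover mphi mw (sigma_finiteT mu) dd.1 dd.2.
have F1 n : (mu (phi @^-1` F n) < +oo)%E.
  have mpF := measurable_preimage mphi (mF n).
  rewrite -(@lte_pmul2l _ (alpha ^+ 2)%:E)//.
  apply: (@le_lt_trans _ _ (wpushforward mu phi w (F n))).
    rewrite /wpushforward -(integral_cst mu mpF).
    apply: ae_ge0_le_integral => //.
    - by move=> x _; rewrite lee_fin ltW.
    - by move=> x _; rewrite lee_fin normsq_ge0.
    - exact/measurable_funTS/measurable_weight.
    - by apply: filterS w_ge => x wx _; rewrite lee_fin.
  by rewrite gt0_muley ?lte_fin//; exact: Fw.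
have F1' n : (wpushforward mu phi (cst 1%R) (F n) < +oo)%E.
  by rewrite (wpush_one mu mphi (mF n)); exact: F1.
split; [|split].
- split; first exact: nonsingular_well_defined.
  move=> W W0 oW; have [u [Wu]] := dd.2 W W0 oW.
  rewrite /dom/= wE /op_comp => Tu; exists u; split => //.
  suff : comp_op mu phi u != None by [].
  by case: (comp_op mu phi u) Tu.
- exact: wE.
rewrite (reciprocal_mul_comp_iff mphi ns mw alpha_gt0 w_ge); split.
  move=> orthP; split.
    exists (alpha ^+ 2)^-1; first by rewrite invr_gt0.
    exact: (RN_deriv_hat_le mphi ns mw alpha_gt0 w_ge FT mF Fw F1').
  have [a [ma a0 aE]] :=
    factor_of_orthc_quotient mphi ns mw alpha_gt0 w_ge orthP FT mF Fmu F1.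
  apply: (@cond_exp_of_factor _ _ _ mu phi mphi _ (EFin \o a) F) => //.
  - exact/measurable_EFinP.
  - exact: measurable_weight.
  - by move=> x; rewrite lee_fin normsq_ge0.
  - by apply: filterS aE => x ->.
move=> [_ wc]; have [b [mb b0 bE]] := cond_exp_factor mu phi (fun y => (normsq (w y))%:E).
apply: (@orthc_quotient_of_factor _ _ _ mu phi w alpha mphi ns mw alpha_gt0 w_ge (fine \o b)).
  by apply: measurableT_comp mb; exact: fine_measurable.
by apply: filterS wc => x wx; rewrite /= -bE -wx.
Qed.
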